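(* Let $d\in\mathbb{N}^*$, $r\in[1,d]$, $c_*\ge 1$, $\upsilon\in[0,1]$, $\mu_1,\dots,\mu_d>0$, $d_*=\sum_{i=1}^d\mu_i$ and $\delta\ge 0$. Consider, for $n$ large enough, the sequence model $$y_{j,\ell,\mathbf{k}}=\theta_{j,\ell,\mathbf{k}}+n^{-r/2}z_{j,\ell,\mathbf{k}},\qquad j=0,\dots,J,\ \ell\in B_j,\ \mathbf{k}\in D_j.$$ Suppose that, for any $j\in\{0,\dots,J\}$ and any $\ell\in B_j$, $(z_{j,\ell,\mathbf{k}})_{\mathbf{k}}$ is a centered Gaussian process. Assume that there exist two constants $Q_3>0$ and $Q_4>0$ (independent of $n$) such that: (A3) $\displaystyle\sup_{j\in\{0,\dots,J\}}\sup_{\ell\in B_j}\sup_{\mathbf{k}\in D_j}2^{-2\delta j}\,\mathbb{E}\left(z_{j,\ell,\mathbf{k}}^4\right)\le Q_3$; (A4) for any $a=(a_{\mathbf{k}})_{\mathbf{k}\in D_j}$ such that $\sup_{j\in\{0,\dots,J\}}\sup_{\mathbf{K}\in\mathcal{A}_j}\sum_{\mathbf{k}\in U_{j,\mathbf{K}}}a_{\mathbf{k}}^2\le 1$, we have $$\sup_{j\in\{0,\dots,J\}}\sup_{\ell\in B_j}\sup_{\mathbf{K}\in\mathcal{A}_j}2^{-\delta j}\,\mathbb{E}\left(\Big(\sum_{\mathbf{k}\in U_{j,\mathbf{K}}}a_{\mathbf{k}}z_{j,\ell,\mathbf{k}}\Big)^2\right)\le Q_4.$$ Then, with $\lambda_*=4\left((2Q_4)^{1/2}+Q_3^{1/4}\right)^2$,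 the following two conditions are satisfied for some constants $Q_1,Q_2>0$ independent of $n$: (A1) $\displaystyle \sup_{j\in\{0,\dots,J\}}\sup_{\ell\in B_j}2^{-j(d_*+\delta)}\sum_{\mathbf{k}\in D_j}\mathbb{E}\left(z_{j,\ell,\mathbf{k}}^2\right)\le Q_1$; (A2) $\displaystyle \sum_{j=j_0}^{J_*}\sum_{\ell\in B_j}\sum_{\mathbf{K}\in\mathcal{A}_j}\sum_{\mathbf{k}\in U_{j,\mathbf{K}}}\mathbb{E}\left(z_{j,\ell,\mathbf{k}}^2\,\mathbf{1}_{\left\{\sum_{\mathbf{k}'\in U_{j,\mathbf{K}}}z_{j,\ell,\mathbf{k}'}^2>\lambda_*2^{\delta j}L^d/4\right\}}\right)\le Q_2$. Therefore, for the block estimator $\widehat\theta^*$ defined in the context with $\delta$ and this $\lambda_*$, and for $s>0$, $0<p\le\infty$, $0<q\le\infty$, $M\in(0,\infty)$, there exists a constant $C>0$ (independent of $n$) such that $\sup_{\theta\in\boldsymbol{\Theta}^s_{p,q}(M)}R(\widehat\theta^*,\theta)\le C\rho_n$, where $$\rho_n=\begin{cases} n^{-2sr/(2s+\delta+d_*+\upsilon)}, & \text{for } q\le 2\le p,\\ (\log n/n)^{2sr/(2s+\delta+d_*+\upsilon)}, & \text{for } q\le p<2,\ sp>\max\left(d_*,(1-p/2)(\delta+d_*+\upsilon)\right),\end{cases}$$ and, if $\upsilon=0$, these rates (respectively for $p\ge 2$, and for $p<2$ with $sp>\max(d_*,(1-p/2)(\delta+d_* ))$) hold without the restriction $q\l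e\min(p,2)$.
   Context: Notation. $\log$ is the natural logarithm, $\lfloor\cdot\rfloor$ is the floor, $(x)_+=\max(x,0)$, $\mathbb{N}^*=\{1,2,\dots\}$. Index sets. $J=\lfloor\log_2 n\rfloor$. For every integer $j\ge 0$: $B_j=\{1,\dots,\lfloor c_*2^{\upsilon j}\rfloor\}$ and $D_j=\prod_{i=1}^d\{0,\dots,\lfloor 2^{\mu_i j}\rfloor-1\}$; $\mathbf{k}=(k_1,\dots,k_d)$ denotes an element of $D_j$. Blocks. $L=\lfloor(r\log n)^{1/d}\rfloor$ is the block length, $j_0=\lfloor(1/\min_{i=1,\dots,d}\mu_i)\log_2 L\rfloor$ is the coarsest scale, and $J_*=\lfloor (r/(d_*+\delta+\upsilon))\log_2 n\rfloor$. For $j\in\{j_0,\dots,J_*\}$, $\mathcal{A}_j=\prod_{i=1}^d\{1,\dots,\lfloor 2^{\mu_i j}L^{-1}\rfloor\}$ is the set of block indices at scale $j$, and for $\mathbf{K}=(K_1,\dots,K_d)\in\mathcal{A}_j$, $U_{j,\mathbf{K}}=\{\mathbf{k}\in D_j:\ (K_i-1)L\le k_i\le K_iL-1\text{ for }i=1,\dots,d\}$; in (A4) the same formulas are used for the other values of $j$. Convention: rounding effects at the boundary are ignored, i.e. for $j\in\{j_0,\dots,J_*\}$ the blocks $U_{j,\mathbf{K}}$, $\mathbf{K}\in\mathcal{A}_j$, are regarded as covering $D_j$, so that $\sum_{\mathbf{k}\in D_j}$ is identified with $\sum_{\mathbf{K}\in\mathcal{A}_j}\sum_{\mathbf{k}\in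 U_{j,\mathbf{K}}}$. Estimator. For $\ell\in B_j$ and $\mathbf{k}\in D_j$ (with, when $j\in\{j_0,\dots,J_*\}$, $\mathbf{K}\in\mathcal{A}_j$ the index of the block such that $\mathbf{k}\in U_{j,\mathbf{K}}$), $$\widehat\theta^*_{j,\ell,\mathbf{k}}=\begin{cases} y_{j,\ell,\mathbf{k}}, & j\in\{0,\dots,j_0-1\},\\ y_{j,\ell,\mathbf{k}}\left(1-\dfrac{\lambda_*n^{-r}2^{\delta j}}{\frac{1}{L^d}\sum_{\mathbf{k}'\in U_{j,\mathbf{K}}}y_{j,\ell,\mathbf{k}'}^2}\right)_+, & j\in\{j_0,\dots,J_*\},\\ 0, & j\in\mathbb{N}\setminus\{0,\dots,J_*\},\end{cases}$$ with value $0$ in the second case if the block sum of squares vanishes. Risk. For a family $\theta=(\theta_{j,\ell,\mathbf{k}})_{j\ge 0,\ell\in B_j,\mathbf{k}\in D_j}$ of reals, $R(\widehat\theta,\theta)=\sum_{j=0}^\infty\sum_{\ell\in B_j}\sum_{\mathbf{k}\in D_j}\mathbb{E}\left((\widehat\theta_{j,\ell,\mathbf{k}}-\theta_{j,\ell,\mathbf{k}})^2\right)$. Smoothness space. $\boldsymbol{\Theta}^s_{p,q}(M)$ is the set of $\theta$ such that $$\left(\sum_{j=0}^\infty\sum_{\ell\in B_j}\left(2^{j(s+d_*/2-d_*/p)}\Big(\sum_{\mathbf{k}\in D_j}|\theta_{j,\ell,\mathbf{k}}|^p\Big)^{1/p}\right)^q\right)^{1/q}\le M,$$ with the usual supremum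 modifications if $p=\infty$ or $q=\infty$ (and $d_*/p=0$ if $p=\infty$).
   Formalization: (A2) and the risk bounds are proved for those n with J_* ≤ J (automatic when r ≤ d_*+δ+υ); otherwise (A2) and the estimator would involve levels j > J, at which the model defines no y or z. *)

(* Defs.v *)
From HB Require Import structures.
From mathcomp Require Import all_boot all_order all_algebra.
From mathcomp Require Import all_classical all_reals all_analysis.

Set Implicit Arguments.
Unset Strict Implicit.
Unset Printing Implicit Defensive.

Import Order.TTheory GRing.Theory Num.Theory.
Import numFieldNormedType.Exports.

Local Open Scope classical_set_scope.
Local Open Scope ring_scope.

(* On nonnegative reals Num.truncn is the floor. *)

Definition log2 {R : realType} (x : R) : R := ln x / ln 2.

Section Gaussian.
Context {R : realType}.

(* The library's normal_prob is not the point mass when the standard deviation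
   vanishes. *)
Definition normal_law (m sigma : R) : set R -> \bar R :=
  if sigma == 0 then \d_m else normal_prob m sigma.

Definition centered_gaussian_process d (T : measurableType d)
    (P : probability T R) (I : finType) (Z : I -> T -> R) : Prop :=
  forall a : I -> R, exists2 sigma : R, 0 <= sigma &
    forall A : set R, measurable A ->
      P [set w | A (\sum_i a i * Z i w)] = normal_law 0 sigma A.

End Gaussian.

Section IndexSets.
Context {R : realType} {d : nat}.
Variables (mu : 'I_d -> R) (c upsilon : R).

Definition dstar : R := \sum_i mu i.

(* The index l of the text, which runs from 1, is l.+1 here. *)
Definition B (j : nat) : finType :=
  'I_(Num.truncn (c * 2 `^ (upsilon * j%:R))).

Definition side (j : nat) (i : 'I_d) : nat := Num.truncn (2 `^ (mu i * j%:R)).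

Definition D (j : nat) : finType := {dffun forall i : 'I_d, 'I_(side j i)}.

Definition level_family (X : Type) : Type := forall j : nat, B j -> D j -> X.

End IndexSets.

Section Blocks.
Context {R : realType} {d : nat}.
Variables (mu : 'I_d -> R) (upsilon r delta : R) (n : nat).

Definition J : nat := Num.truncn (log2 n%:R : R).

Definition L : nat := Num.truncn ((r * ln n%:R) `^ (d%:R^-1)).

Definition j0 : nat := Num.truncn ((inf (range mu))^-1 * log2 (L%:R : R)).

(* Jstar may exceed J (when r > dstar + delta + upsilon), and the estimator then
   calls for levels that are not observed: what involves the levels up to Jstar
   is only stated under Jstar <= J. *)
Definition Jstar : nat :=
  Num.truncn (r / (dstar mu + delta + upsilon) * log2 (n%:R : R)).

(* Block coordinates are counted from 0: K i is (K_i - 1) in the text. *)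
Definition A (j : nat) : finType :=
  {dffun forall i : 'I_d, 'I_(Num.truncn (2 `^ (mu i * j%:R) / L%:R))}.

Definition U (j : nat) (K : A j) : {set D mu j} :=
  [set k : D mu j | [forall i, (K i * L <= k i)%N && (k i < (K i).+1 * L)%N]].

(* The floors may leave part of D j outside every block. This is summation over
   D j under the convention that this boundary is ignored, i.e. that at the
   levels j0, ..., Jstar the blocks are regarded as a partition of D j. *)
Definition block_sum (j : nat) (F : D mu j -> \bar R) : \bar R :=
  if (j0 <= j <= Jstar)%N
  then (\sum_(K : A j) \sum_(k in U K) F k)%E
  else (\sum_(k : D mu j) F k)%E.

End Blocks.

Arguments J R n : clear implicits.
Arguments L {R} d r n.


Section Estimator.
Context {R : realType} {d : nat}.
Variables (mu : 'I_d -> R) (c upsilon r delta lambda : R) (n : nat).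

(* When the block sum of squares vanishes, so does y j l k, hence the value.
   The default value for a k that belongs to no block never enters the risk. *)
Definition estimator (y : level_family mu c upsilon R) : level_family mu c upsilon R :=
  fun j l k =>
    if (j < j0 mu r n)%N then y j l k
    else if (j <= Jstar mu upsilon r delta n)%N then
      if [pick K : A mu r n j | k \in U K] is Some K then
        y j l k *
        Num.max (1 - lambda * n%:R `^ (- r) * 2 `^ (delta * j%:R) /
                     ((L d r n)%:R ^- d * \sum_(k' in U K) y j l k' ^+ 2)) 0
      else 0
    else 0.

Definition observation (Z theta : level_family mu c upsilon R) :
    level_family mu c upsilon R :=
  fun j l k => theta j l k + n%:R `^ (- r / 2) * Z j l k.

Definition risk disp (T : measurableType disp) (P : probability T R)
    (z : level_family mu c upsilon {RV P >-> R}) (theta : level_family mu c upsilon R) :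
    \bar R :=
  (\sum_(0 <= j <oo) \sum_(l : B c upsilon j)
     block_sum upsilon r delta n (fun k : D mu j =>
       'E_P[fun w =>
         ((estimator (observation (fun j' l' k' => z j' l' k' w) theta) l k
           - theta j l k) ^+ 2)%R]))%E.

End Estimator.

Section NoiseConditions.
Context {R : realType} {d : nat}.
Variables (mu : 'I_d -> R) (c upsilon r delta : R) (n : nat).
Context {disp : measure_display} {T : measurableType disp}
  {P : probability T R}.
Variable z : level_family mu c upsilon {RV P >-> R}.

Local Open Scope ereal_scope.

Definition gaussian_noise : Prop :=
  forall j : nat, (j <= J R n)%N -> forall l : B c upsilon j,
    centered_gaussian_process P (fun (k : D mu j) w => z l k w).

Definition A1 (Q1 : R) : Prop :=
  forall j : nat, (j <= J R n)%N -> forall l : B c upsilon j,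
    (2 `^ (- (j%:R * (dstar mu + delta))))%:E *
      (\sum_(k : D mu j) 'E_P[fun w => (z l k w ^+ 2)%R]) <= Q1%:E.

Definition A2 (lambda Q2 : R) : Prop :=
  \sum_(j0 mu r n <= j < (Jstar mu upsilon r delta n).+1)
    \sum_(l : B c upsilon j) \sum_(K : A mu r n j) \sum_(k in U K)
      'E_P[fun w => (z l k w ^+ 2 *
        \1_[set w' | lambda * 2 `^ (delta * j%:R) * (L d r n)%:R ^+ d / 4
                     < \sum_(k' in U K) z l k' w' ^+ 2] w)%R]
  <= Q2%:E.

Definition A3 (Q3 : R) : Prop :=
  forall j : nat, (j <= J R n)%N ->
  forall (l : B c upsilon j) (k : D mu j),
    (2 `^ (- (2 * delta * j%:R)))%:E * 'E_P[fun w => (z l k w ^+ 4)%R]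
    <= Q3%:E.

Definition A4 (Q4 : R) : Prop :=
  forall a : (forall j : nat, D mu j -> R),
    (forall j : nat, (j <= J R n)%N -> forall K : A mu r n j,
       (\sum_(k in U K) a j k ^+ 2 <= 1)%R) ->
    forall j : nat, (j <= J R n)%N ->
    forall (l : B c upsilon j) (K : A mu r n j),
      (2 `^ (- (delta * j%:R)))%:E *
        'E_P[fun w => ((\sum_(k in U K) a j k * z l k w) ^+ 2)%R] <= Q4%:E.

End NoiseConditions.

Section SmoothnessSpace.
Context {R : realType} {d : nat}.
Variables (mu : 'I_d -> R) (c upsilon s : R) (p q : \bar R).

Definition lp_norm (I : finType) (x : I -> R) : R :=
  if p is p'%:E then (\sum_i `|x i| `^ p') `^ p'^-1
  else \big[Num.max/0]_i `|x i|.

Definition dstar_over_p : R := if p is p'%:E then dstar mu / p' else 0.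

Definition level_norm (theta : level_family mu c upsilon R)
    (j : nat) (l : B c upsilon j) : R :=
  2 `^ (j%:R * (s + dstar mu / 2 - dstar_over_p)) * lp_norm (theta j l).

Definition smoothness_norm (theta : level_family mu c upsilon R) : \bar R :=
  if q is q'%:E then
    poweR (\sum_(0 <= j <oo) \sum_(l : B c upsilon j)
             (level_norm theta l `^ q')%:E)%E q'^-1
  else ereal_sup [set x | exists j (l : B c upsilon j),
                            x = (level_norm theta l)%:E].

Definition Theta (M : R) : set (level_family mu c upsilon R) :=
  [set theta | (smoothness_norm theta <= M%:E)%E].

End SmoothnessSpace.

Arguments Theta {R d} mu c upsilon s p q M.

(* Main.v *)
Require Import Defs.
From HB Require Import structures.
From mathcomp Require Import all_boot all_order all_algebra.
From mathcomp Require Import all_classical all_reals all_analysis.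
From mathcomp Require Import measurable_realfun ring lra complex.

Set Implicit Arguments.
Unset Strict Implicit.
Unset Printing Implicit Defensive.

Import Order.TTheory GRing.Theory Num.Theory.
Import numFieldNormedType.Exports.

Local Open Scope classical_set_scope.
Local Open Scope ring_scope.

(* Given (A3), (A1) follows from [E z^2 <= (E z^4)^(1/2)].

   For (A2), diagonalize the covariance of a block: the block sum of squares is
   a sum of independent squares whose variances are at most
   [V = Q4 2^(delta j)] and add up to at most [tau = L^d Q3^(1/2) 2^(delta j)],
   so that, by concavity of the logarithm,
   [E exp (u |z|^2 / (2 V)) <= exp (- tau ln (1 - u) / (2 V))] for [0 <= u < 1].
   A Chernoff bound then makes [E (|z|^2 1_(|z|^2 > lambda 2^(delta j) L^d / 4))]
   smaller than a constant times [2^(delta j) exp (- (1 + eps) L^d)], hence than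
   a constant times [2^(delta j) n^(-r)], and the sum over the blocks up to
   [Jstar] is geometric.

   For the rates, the loss on a block is at most [10 min (|theta|^2, t_j)], with
   [t_j] the threshold at the block, plus the term controlled by (A2). Let
   [sigma = dstar + delta + upsilon]. Up to the level [j] with
   [2^(j (2 s + sigma)) = n^r] (or [(n / ln n)^r] when [p < 2]) bound the minimum
   by [t_j]; above it bound it by [|theta|^2] if [p >= 2], and by
   [t_j^(1 - p / 2) |theta|_p^p] if [p < 2]. *)

(** * Gaussian quadratic forms *)

(** The constant [lambda] has no fixed margin. With [g = Q3^(1/4) / (2 Q4)^(1/2)], the Chernoff
    exponent at the threshold is [L^d] times [u (1 + g)^2 + g^2 ln (1 - u)]; the maximum of this
    factor exceeds [1], but by an amount that tends to [0] with [g]. That gain has to pay for two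
    losses: the rounding in [L], which may leave [L^d] below [r ln n], and the factor [|z|^2] in
    front of the indicator.

    The Gaussian hypothesis gives the law of each linear combination. The argument therefore invokes
    neither joint densities nor independence: the exponential moment of a square is an average of
    exponentials of linear forms over an auxiliary normal variable, and variances are recovered from
    exponential moments.

    The logarithm of the second rate comes from the factor [L^d] of the threshold: it cancels
    against the number of blocks when each block pays the full threshold, and stays in the
    interpolated bound for [p < 2]. Levels below [j0] cost [n^(-r)] up to powers of [ln n],
    negligible because the exponent of the rate is smaller than [r]. *)

Section Density.
Context d (T : measurableType d) (R : realType).
Variables (mu nu : {measure set T -> \bar R}) (g : T -> R).
Hypotheses (mg : measurable_fun setT g) (g_ge0 : forall x, 0 <= g x).
Hypothesis nuE : forall A, measurable A ->
  nu A = (\int[mu]_(x in A) (g x)%:E)%E.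

Local Open Scope ereal_scope.
Import HBNNSimple.

Let integral_density_indic A : measurable A ->
  \int[nu]_x (\1_A x)%:E = \int[mu]_x ((\1_A x)%:E * (g x)%:E).
Proof.
move=> mA; rewrite integral_indic//= setIT nuE// integral_mkcond.
apply: eq_integral => x _; rewrite patchE indicE.
by case: ifPn => xA; rewrite ?mul1e ?mul0e.
Qed.

Let integral_density_nnsfun (f : {nnsfun T >-> R}) :
  \int[nu]_x (f x)%:E = \int[mu]_x ((f x)%:E * (g x)%:E).
Proof.
have mgE : measurable_fun setT (fun x => (g x)%:E) by exact/measurable_EFinP.
under [LHS]eq_integral do rewrite fimfunE -fsumEFin//.
rewrite [LHS]ge0_integral_fsum//; last 2 first.
  - by move=> r; exact/measurable_EFinP/measurableT_comp.
  - by move=> n x _; rewrite EFinM nnfun_muleindic_ge0.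
under [RHS]eq_integral.
  move=> x _; rewrite fimfunE -fsumEFin// muleC ge0_mule_fsumr; last first.
    by move=> r; rewrite EFinM nnfun_muleindic_ge0.
  over.
have mind (r : R) : measurable_fun setT
    (fun x => (r * \1_(f @^-1` [set r]) x)%R%:E).
  by apply/measurable_EFinP; apply: measurable_funM => //; exact: measurable_indic.
rewrite [RHS]ge0_integral_fsum//; last 2 first.
  - by move=> r; apply: emeasurable_funM.
  - move=> r x _; rewrite mule_ge0//; first by rewrite lee_fin.
    by rewrite EFinM nnfun_muleindic_ge0.
apply: eq_fsbigr => r.
rewrite inE/= => -[x _ <-]; have fx0 : (0 <= f x)%R by [].
have m1 : measurable_fun setT (fun y => (\1_(f @^-1` [set f x]) y)%:E : \bar R).
  by apply/measurable_EFinP; exact: measurable_indic.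
have fx0E : 0 <= (f x)%:E by rewrite lee_fin.
have i0 y : [set: T] y -> 0 <= (\1_(f @^-1` [set f x]) y : R)%:E.
  by rewrite lee_fin.
transitivity ((f x)%:E * \int[nu]_y (\1_(f @^-1` [set f x]) y)%:E).
  by rewrite -(ge0_integralZl nu measurableT m1 i0 fx0E).
rewrite integral_density_indic//.
rewrite -(ge0_integralZl mu measurableT (emeasurable_funM m1 mgE) _ fx0E).
  by apply: eq_integral => y _; rewrite EFinM muleA muleC.
by move=> y _; rewrite mule_ge0// lee_fin.
Qed.

(** The usual ladder: [nuE] is the case of indicators, finite sums give simple functions, and
    monotone convergence along [nnsfun_approx], under both measures, gives the rest. *)
Lemma ge0_integral_density (f : T -> \bar R) : measurable_fun setT f ->
  (forall x, 0 <= f x) -> \int[nu]_x f x = \int[mu]_x (f x * (g x)%:E).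
Proof.
move=> mf f0; have mgE : measurable_fun setT (fun x => (g x)%:E) by exact/measurable_EFinP.
pose f_ := nnsfun_approx measurableT mf.
have fE x : (EFin \o f_ ^~ x) n @[n --> \oo] --> f x.
  by apply: cvg_nnsfun_approx.
transitivity (lim (\int[nu]_x (f_ n x)%:E @[n --> \oo])).
  rewrite -monotone_convergence//=.
  - apply: eq_integral => x _; apply/esym/cvg_lim => //; exact: fE.
  - by move=> n; exact/measurable_EFinP.
  - by move=> n ? _; rewrite lee_fin.
  - by move=> ? _ ? ? mn; rewrite lee_fin; exact/lefP/nd_nnsfun_approx.
transitivity (lim (\int[mu]_x ((f_ n x)%:E * (g x)%:E) @[n --> \oo])).
  by under eq_fun do rewrite integral_density_nnsfun.
rewrite -monotone_convergence//=.
- apply: eq_integral => x _; apply/cvg_lim => //.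
  by apply: cvgeZr => //; exact: fE.
- by move=> n; apply: emeasurable_funM => //; exact/measurable_EFinP.
- by move=> n ? _; rewrite mule_ge0 ?lee_fin.
- move=> ? _ ? ? mn; rewrite lee_wpmul2r ?lee_fin//.
  exact/lefP/nd_nnsfun_approx.
Qed.

End Density.

(** * Exponential moments of centered normal laws *)

Section NormalMoments.
Context {R : realType}.
Implicit Types (s t x : R).

Let mu : {measure set (measurableTypeR R) -> \bar R} := @lebesgue_measure R.

Let measurable_funM_sqr t :
  measurable_fun [set: measurableTypeR R] (fun x : measurableTypeR R => t * x ^+ 2).
Proof. by apply: measurable_funM => //; apply: exprn_measurable. Qed.

Let sqr_exponent s t x k : s != 0 -> 0 < k -> k = 1 - 2 * t * s ^+ 2 ->
  - x ^+ 2 / (s ^+ 2 *+ 2) + t * x ^+ 2 = - x ^+ 2 / (s ^+ 2 / k *+ 2).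
Proof.
move=> s0 k_gt0 kE; have k0 : k != 0 by rewrite gt_eqF.
have double (y : R) : y *+ 2 = y * 2 by rewrite mulr_natr.
rewrite (double (s ^+ 2)) (double (s ^+ 2 / k)).
have -> : - x ^+ 2 / (s ^+ 2 / k * 2) = - x ^+ 2 * k / (s ^+ 2 * 2).
  by field; rewrite s0.
by rewrite kE; field.
Qed.

Lemma measurable_expR_linear t :
  measurable_fun [set: measurableTypeR R] (fun x => (expR (t * x))%:E).
Proof.
by apply/measurable_EFinP; apply: measurableT_comp => //; exact: measurable_funM.
Qed.

Lemma measurable_expR_sqr t :
  measurable_fun [set: measurableTypeR R] (fun x => (expR (t * x ^+ 2))%:E).
Proof.
apply/measurable_EFinP; apply: measurableT_comp => //; exact: measurable_funM_sqr.
Qed.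

Lemma ge0_integral_normal_prob m s (f : measurableTypeR R -> \bar R) :
  measurable_fun setT f -> (forall x, 0 <= f x)%E ->
  (\int[normal_prob m s]_x f x = \int[mu]_x (f x * (normal_pdf m s x)%:E))%E.
Proof.
move=> mf f0; apply: ge0_integral_density => //.
- exact: measurable_normal_pdf.
- exact: normal_pdf_ge0.
Qed.

(** Completing the square: [expR (t * x)] times the density centered at [0] is a constant times the
    density centered at [t * s ^+ 2]. *)
Lemma normal_prob_mgf s t : s != 0 ->
  (\int[normal_prob 0 s]_x (expR (t * x))%:E = (expR (t ^+ 2 * s ^+ 2 / 2))%:E)%E.
Proof.
move=> s0; rewrite ge0_integral_normal_prob; last 2 first.
- exact: measurable_expR_linear.
- by move=> x; rewrite lee_fin expR_ge0.
transitivity (\int[mu]_x ((expR (t ^+ 2 * s ^+ 2 / 2))%:E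
    * (normal_pdf (t * s ^+ 2) s x)%:E))%E.
  apply: eq_integral => x _; rewrite -!EFinM !normal_pdfE//; congr (_%:E).
  rewrite /normal_fun mulrCA [RHS]mulrCA -!expRD; congr (_ * expR _).
  by field.
rewrite ge0_integralZl//.
- by rewrite integral_normal_pdf mule1.
- by apply/measurable_EFinP; exact: measurable_normal_pdf.
- by move=> x _; rewrite lee_fin normal_pdf_ge0.
Qed.

Lemma normal_prob_sqr_mgf s t : s != 0 -> 2 * t * s ^+ 2 < 1 ->
  (\int[normal_prob 0 s]_x (expR (t * x ^+ 2))%:E
    = ((Num.sqrt (1 - 2 * t * s ^+ 2))^-1)%:E)%E.
Proof.
move=> s0 ts; rewrite ge0_integral_normal_prob; last 2 first.
- exact: measurable_expR_sqr.
- by move=> x; rewrite lee_fin expR_ge0.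
have k0 : 0 < 1 - 2 * t * s ^+ 2 by rewrite subr_gt0.
move kE : (1 - 2 * t * s ^+ 2) k0 => k k0.
(* The tilted density is a centered normal density of variance [s ^+ 2 / k], up to the ratio of the
   two peaks, which is the inverse of [Num.sqrt k]. *)
pose s' := s / Num.sqrt k.
have sk0 : 0 < Num.sqrt k by rewrite sqrtr_gt0.
have s'0 : s' != 0 by rewrite mulf_neq0// invr_neq0// gt_eqF.
have s'2 : s' ^+ 2 = s ^+ 2 / k by rewrite exprMn exprVn sqr_sqrtr// ltW.
have peakE : normal_peak s = (Num.sqrt k)^-1 * normal_peak s'.
  rewrite /normal_peak s'2 -invfM -sqrtrM ?ltW//; congr (Num.sqrt _)^-1.
  by rewrite -!mulrnAr [RHS]mulrA [k * _]mulrC divfK// gt_eqF.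
transitivity (\int[mu]_x (((Num.sqrt k)^-1)%:E * (normal_pdf 0 s' x)%:E))%E.
  apply: eq_integral => x _; rewrite -!EFinM !normal_pdfE//; congr (_%:E).
  rewrite peakE mulrC -!mulrA; congr (_ * (_ * _)).
  by rewrite /normal_fun -expRD s'2 subr0; congr expR; exact: sqr_exponent (esym kE).
rewrite ge0_integralZl//.
- by rewrite integral_normal_pdf mule1.
- by apply/measurable_EFinP; exact: measurable_normal_pdf.
- by move=> x _; rewrite lee_fin normal_pdf_ge0.
Qed.

Section Law.
Context d (T : measurableType d) (P : probability T R) (Y : T -> R) (s : R).
Hypotheses (mY : measurable_fun setT Y).
Hypothesis Ylaw : forall A : set R, measurable A ->
  P [set w | A (Y w)] = normal_law 0 s A.

(** The Dirac case [s = 0] is isolated here. The two closed forms below cover it, so that degenerate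
    combinations need no separate treatment afterwards. *)
Let integral_law (f : measurableTypeR R -> R) :
  measurable_fun setT f -> (forall x, 0 <= f x) ->
  (\int[P]_w (f (Y w))%:E =
    if s == 0%R then (f 0%R)%:E else \int[normal_prob 0 s]_x (f x)%:E)%E.
Proof.
move=> mf f0; have mfE : measurable_fun setT (EFin \o f) by exact/measurable_EFinP.
have mY' : @measurable_fun _ _ T (measurableTypeR R) setT Y by exact: mY.
pose Ym := HB.pack_for {mfun T >-> measurableTypeR R} Y
  (@isMeasurableFun.Build _ _ T (measurableTypeR R) Y mY').
have -> : (\int[P]_w (f (Y w))%:E = \int[distribution P Ym]_x (f x)%:E)%E.
  by rewrite ge0_integral_distribution// => x; rewrite lee_fin.
have [s0|s0] := eqVneq s 0.
  rewrite (@eq_measure_integral _ _ _ _ (\d_(0 : measurableTypeR R))).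
    by rewrite integral_dirac//= diracT mul1e.
  move=> A mA _; rewrite [LHS](Ylaw mA) /normal_law s0 eqxx//.
rewrite (@eq_measure_integral _ _ _ _ (normal_prob 0 s))//.
by move=> A mA _; rewrite [LHS](Ylaw mA) /normal_law (negbTE s0).
Qed.

Lemma normal_law_mgf t :
  (\int[P]_w (expR (t * Y w))%:E = (expR (t ^+ 2 * s ^+ 2 / 2))%:E)%E.
Proof.
rewrite (@integral_law (fun x => expR (t * x))); last 2 first.
- by apply: measurableT_comp => //; exact: measurable_funM.
- by move=> x; rewrite expR_ge0.
have [->|s0] := eqVneq s 0; last exact: normal_prob_mgf.
by rewrite mulr0 expr0n/= mulr0 mul0r.
Qed.

Lemma normal_law_sqr_mgf t : 2 * t * s ^+ 2 < 1 ->
  (\int[P]_w (expR (t * Y w ^+ 2))%:E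
    = ((Num.sqrt (1 - 2 * t * s ^+ 2))^-1)%:E)%E.
Proof.
move=> ts; rewrite (@integral_law (fun x => expR (t * x ^+ 2))); last 2 first.
- apply: measurableT_comp => //; exact: measurable_funM_sqr.
- by move=> x; rewrite expR_ge0.
have [->|s0] := eqVneq s 0; last exact: normal_prob_sqr_mgf.
by rewrite expr0n/= !mulr0 expR0 subr0 sqrtr1 invr1.
Qed.

End Law.
End NormalMoments.

(** * Diagonalization of real symmetric matrices *)

Section Spectral.
Context {R : rcfType}.

(** Over the complex numbers [A] is hermitian, so its spectral diagonal is real; being an eigenvalue
    is insensitive to the field extension, hence the descent to [R]. *)
Lemma symmetric_eigenvalue n (A : 'M[R]_n.+1) : A^T = A ->
  exists a, eigenvalue A a.
Proof.
move=> symA; pose B := map_mx (real_complex R) A.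
have hermB : B \is hermsymmx.
  apply: realsym_hermsym.
    rewrite is_hermitianmxE expr0 scale1r map_mx_id// /B map_trmx symA//.
  by apply/mxOverP => i j; rewrite mxE complex_real.
have [a aE] : exists a, spectral_diag B 0 0 = (real_complex R) a.
  apply/complex_realP; exact: (mxOverP (hermitian_spectral_diag_real hermB)).
exists a; rewrite -(eigenvalue_map (real_complex R)).
apply/eigenvalueP; exists (row 0 (spectralmx B)).
  rewrite -[X in X *: _]aE; have /orthomx_spectralP BE := hermitian_normalmx hermB.
  rewrite -/B [X in _ *m X]BE -!row_mul !mulmxA mulmxV ?spectral_unit// mul1mx.
  by apply/rowP => j; rewrite mxE mul_diag_mx !mxE.
apply: contraTneq (spectral_unitarymx B) => P0.
apply/negP => /unitarymxP /(congr1 (fun M => fun_of_matrix M 0 0)).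
rewrite [RHS]mxE eqxx mxE big1 => [/eqP|i _]; first by rewrite eq_sym oner_eq0.
by have /rowP/(_ i) := P0; rewrite !mxE => ->; rewrite mul0r.
Qed.

Lemma sqnorm_ge0 n (v : 'rV[R]_n) : 0 <= (v *m v^T) 0 0.
Proof. by rewrite mxE sumr_ge0// => i _; rewrite mxE -expr2 sqr_ge0. Qed.

Lemma sqnorm_eq0 n (v : 'rV[R]_n) : (v *m v^T) 0 0 = 0 -> v = 0.
Proof.
rewrite mxE => /eqP; rewrite psumr_eq0 => [/allP v0|i _]; last first.
  by rewrite mxE -expr2 sqr_ge0.
apply/rowP => i; apply/eqP; have := v0 i; rewrite mem_index_enum => /(_ isT).
by rewrite !mxE -expr2 sqrf_eq0.
Qed.

(* The Householder reflection along [e - u], which exchanges the unit vectors. *)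
Lemma householder n (e u : 'rV[R]_n) :
  (e *m e^T) 0 0 = 1 -> (u *m u^T) 0 0 = 1 ->
  exists H : 'M[R]_n, [/\ H^T = H, H *m H = 1%:M & e *m H = u].
Proof.
move=> e1 u1; have [->|eu] := eqVneq e u.
  by exists 1%:M; rewrite trmx1 !mulmx1.
pose w := e - u; pose k := (w *m w^T) 0 0.
have k0 : k != 0.
  by apply: contra eu => /eqP /sqnorm_eq0 /eqP; rewrite subr_eq0.
have wwE : w *m w^T = k%:M by rewrite [LHS]mx11_scalar.
exists (1%:M - (2 / k) *: (w^T *m w)); split.
- by rewrite linearB/= linearZ/= trmx1 trmx_mul trmxK.
- set M := w^T *m w; have MM : M *m M = k *: M.
    by rewrite /M mulmxA -(mulmxA w^T) wwE mul_mx_scalar -scalemxAl.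
  rewrite mulmxBl mul1mx mulmxBr mulmx1 -scalemxAl -scalemxAr MM !scalerA.
  have -> : 2 / k * (2 / k) * k = 2 / k + 2 / k by field.
  by rewrite scalerDl opprB addrK subrK.
have euT : u *m e^T = e *m u^T.
  by rewrite [LHS]mx11_scalar [RHS]mx11_scalar !mxE; congr (_%:M);
    apply: eq_bigr => i _; rewrite !mxE mulrC.
have sub1 (X Y : 'M[R]_1) : (X - Y) 0 0 = X 0 0 - Y 0 0 by rewrite !mxE.
have kE : k = 2 - 2 * (e *m u^T) 0 0.
  by rewrite /k /w linearB/= mulmxBl !mulmxBr euT !sub1 e1 u1; ring.
rewrite mulmxBr mulmx1 -scalemxAr mulmxA.
have -> : e *m w^T = (k / 2)%:M.
  rewrite [LHS]mx11_scalar; congr (_%:M); by rewrite kE /w linearB/= mulmxBr sub1 e1; field.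
rewrite mul_scalar_mx scalerA.
have -> : 2 / k * (k / 2) = 1 by field.
by rewrite scale1r /w opprB addrC subrK.
Qed.

(** Induction on the dimension. A reflection exchanges the first basis vector with a unit
    eigenvector; after conjugation the first row is a multiple of that basis vector, symmetry clears
    the first column as well, and a smaller symmetric block remains. *)
Lemma symmetric_diagonalization n (A : 'M[R]_n) : A^T = A ->
  exists2 O : 'M[R]_n, O *m O^T = 1%:M & is_diag_mx (O *m A *m O^T).
Proof.
elim: n A => [|n IHn] A symA.
  by exists 1%:M; [rewrite trmx1 mulmx1|apply/is_diag_mxP => -[]].
have [a /eigenvalueP[v vA v0]] := symmetric_eigenvalue symA.
pose k := (v *m v^T) 0 0.
have k_gt0 : 0 < k.
  by rewrite lt_neqAle sqnorm_ge0 andbT eq_sym; apply: contra v0 => /eqP/sqnorm_eq0/eqP.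
pose u := (Num.sqrt k)^-1 *: v.
have uA : u *m A = a *: u by rewrite -scalemxAl vA !scalerA mulrC.
have u1 : (u *m u^T) 0 0 = 1.
  rewrite linearZ/= -scalemxAl -scalemxAr scalerA mxE -/k -expr2 exprVn.
  by rewrite sqr_sqrtr ?ltW// mulVf// gt_eqF.
pose e : 'rV[R]_(1 + n) := row_mx 1%:M 0.
have e1 : (e *m e^T) 0 0 = 1.
  by rewrite tr_row_mx mul_row_col trmx1 mulmx1 mul0mx addr0 mxE.
have [H [HT HH eH]] := householder e1 u1.
have symB : (H *m A *m H)^T = H *m A *m H.
  by rewrite !trmx_mul HT symA mulmxA.
have eB : e *m (H *m A *m H) = a *: e.
  by rewrite !mulmxA eH uA -scalemxAl -eH -mulmxA HH mulmx1.
move: symB eB; set B : matrix R (1 + n) (1 + n) := H *m A *m H => symB eB.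
have BE : B = block_mx a%:M 0 0 (drsubmx B).
  have ul : usubmx B = row_mx a%:M 0.
    have eBu : e *m B = usubmx B.
      by rewrite -{1}[B]vsubmxK mul_row_col mul1mx mul0mx addr0.
    by rewrite -eBu eB scale_row_mx scaler0 scalemx1.
  have ul1 : ulsubmx B = a%:M by rewrite /ulsubmx ul row_mxKl.
  have ur0 : ursubmx B = 0 by rewrite /ursubmx ul row_mxKr.
  rewrite -{1}[B]submxK ul1 ur0; congr block_mx.
  by rewrite -[LHS]trmxK trmx_dlsub symB ur0 trmx0.
have [|O OO diagO] := IHn (drsubmx B).
  by rewrite trmx_drsub symB.
pose Q : matrix R (1 + n) (1 + n) := block_mx 1%:M 0 0 O.
have QT : Q^T = block_mx 1%:M 0 0 O^T by rewrite tr_block_mx trmx1 !trmx0.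
have QQ : Q *m Q^T = 1%:M.
  rewrite QT mulmx_block !mulmx0 !mul0mx !mulmx1 !addr0 !add0r OO.
  by rewrite -scalar_mx_block.
have QBQ : is_diag_mx (Q *m B *m Q^T).
  rewrite QT BE !mulmx_block !mulmx0 !mul0mx !mulmx1 !mul1mx !addr0 !add0r.
  by rewrite is_diag_block_mx// mul0mx !eqxx diagO scalar_mx_is_diag.
exists (Q *m H); rewrite trmx_mul HT !mulmxA.
  by rewrite -(mulmxA _ H H) HH mulmx1.
have -> : Q *m H *m A *m H *m Q^T = Q *m B *m Q^T. by rewrite /B !mulmxA.
exact: QBQ.
Qed.

End Spectral.

(** * Second moments, and exponential moments of sums of squares *)

Section GaussianChaos.
Context {R : realType} d (T : measurableType d) (P : probability T R).

(** Taylor bound at [0] with a quadratic error, valid for negative [x] too: the second moment is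
    squeezed by using both signs. *)
Lemma inv_sqrt_1sub_le (x : R) : x <= 1 / 2 ->
  (Num.sqrt (1 - x))^-1 <= 1 + x / 2 + x ^+ 2.
Proof.
move=> x2; have y0 : 0 < 1 - x by lra.
have a0 : 0 <= 1 + x / 2 + x ^+ 2 by nra.
rewrite -[leLHS]mul1r ler_pdivrMr ?sqrtr_gt0//.
rewrite -[_ + x ^+ 2]ger0_norm// -sqrtr_sqr -sqrtrM ?sqr_ge0//.
rewrite -[leLHS]sqrtr1 ler_wsqrtr// -subr_ge0.
have -> : (1 + x / 2 + x ^+ 2) ^+ 2 * (1 - x) - 1
  = x ^+ 2 * ((1 - x) * 5 / 4 - x * x ^+ 2) by field.
rewrite mulr_ge0 ?sqr_ge0//; have := sqr_ge0 x; nra.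
Qed.

(** The second moment is the derivative at [0] of the exponential moment of [Y ^+ 2]. The inequality
    [1 + y <= expR y] is integrated with [y = t Y^2] for the upper bound and [y = - t Y^2] for the
    lower one, and [t] is then taken arbitrarily small. *)
Lemma normal_law_sqr (Y : T -> R) (s : R) : measurable_fun setT Y ->
  (forall A : set R, measurable A -> P [set w | A (Y w)] = normal_law 0 s A) ->
  (\int[P]_w (Y w ^+ 2)%:E = (s ^+ 2)%:E)%E.
Proof.
move=> mY law; set I := (\int[P]_w _)%E.
have mY2 : measurable_fun setT (fun w => Y w ^+ 2) by exact: measurable_funX.
have mexp t : measurable_fun setT (fun w => expR (t * Y w ^+ 2)).
  by apply: measurableT_comp => //; exact: measurable_funM.
have I0 : (0 <= I)%E by apply: integral_ge0 => w _; rewrite lee_fin sqr_ge0.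
have mom t : 2 * t * s ^+ 2 <= 1 / 2 ->
    (\int[P]_w (expR (t * Y w ^+ 2))%:E <=
      (1 + t * s ^+ 2 + 4 * t ^+ 2 * s ^+ 4)%:E)%E.
  move=> ts; rewrite (normal_law_sqr_mgf mY law); last by lra.
  rewrite lee_fin (le_trans (inv_sqrt_1sub_le ts))// le_eqVlt; apply/orP; left.
  by apply/eqP; field.
have upper t : 0 < t -> 2 * t * s ^+ 2 <= 1 / 2 ->
    (t%:E * I <= (t * s ^+ 2 + 4 * t ^+ 2 * s ^+ 4)%:E)%E.
  move=> t0 ts; rewrite -(leeD2lE (x := 1%:E))// -EFinD addrA.
  apply: le_trans (mom t ts).
  rewrite -[X in (X + _)%E](@probability_setT _ _ _ P) -[P _]mul1e -integral_cst//.
  rewrite -ge0_integralZl//; last 3 first.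
  - by apply/measurable_EFinP.
  - by move=> w _; rewrite lee_fin sqr_ge0.
  - by rewrite lee_fin ltW.
  rewrite -ge0_integralD//; last 2 first.
  - by move=> w _; rewrite -EFinM lee_fin mulr_ge0 ?sqr_ge0// ltW.
  - by apply/measurable_EFinP; exact: measurable_funM.
  apply: ge0_le_integral => //.
  - by move=> w _; rewrite -EFinM -EFinD lee_fin addr_ge0// mulr_ge0 ?sqr_ge0// ltW.
  - by apply/measurable_EFinP; apply: measurable_funD => //; exact: measurable_funM.
  - by apply/measurable_EFinP.
  - by move=> w _; rewrite -EFinM -EFinD lee_fin expR_ge1Dx.
pose t0 := (4 * (1 + s ^+ 2))^-1.
have s2 := sqr_ge0 s; have k0 : 0 < 4 * (1 + s ^+ 2) by lra.
have t0_gt0 : 0 < t0 by rewrite invr_gt0.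
have t0s t : t <= t0 -> 2 * t * s ^+ 2 <= 1 / 2.
  move=> tt0; have : t0 * (4 * (1 + s ^+ 2)) = 1 by rewrite mulVf// gt_eqF.
  nra.
(* The upper bound at the single value [t0] gives finiteness; [I] can then be handled as a real
   number. *)
have Ifin : I \is a fin_num.
  rewrite ge0_fin_numE//; have := upper _ t0_gt0 (t0s _ (lexx _)).
  case: (I) I0 => [x _ _|_|//]; first exact: ltry.
  by rewrite gt0_muley ?lte_fin.
have [i iE] : exists i, I = i%:E by exists (fine I); rewrite fineK.
rewrite iE in I0 upper *; rewrite lee_fin in I0; congr (_%:E).
have Q0 : 0 <= 4 * s ^+ 4 by rewrite mulr_ge0// (exprM s 2 2) sqr_ge0.
have small (e : R) : 0 < e -> exists2 t, 0 < t <= t0 & t * (4 * s ^+ 4) <= e.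
  move=> e0; exists (Num.min t0 (e / (1 + 4 * s ^+ 4))).
    by rewrite lt_min t0_gt0 divr_gt0 ?ge_min ?lexx//; lra.
  apply: (@le_trans _ _ (e / (1 + 4 * s ^+ 4) * (4 * s ^+ 4))).
    by rewrite ler_wpM2r// ge_min lexx orbT.
  by rewrite mulrAC ler_pdivrMr; [nra|lra].
apply/eqP; rewrite eq_le; apply/andP; split; apply/ler_addgt0Pr => e /small[t /andP[t_gt0 tt0] te].
- have := upper t t_gt0 (t0s _ tt0); rewrite -EFinM lee_fin.
  have -> : t * s ^+ 2 + 4 * t ^+ 2 * s ^+ 4 = t * (s ^+ 2 + t * (4 * s ^+ 4)) by ring.
  by rewrite ler_pM2l// => /le_trans; apply; rewrite lerD2l.
- have nt : 2 * (- t) * s ^+ 2 <= 1 / 2 by nra.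
  have : (1 <= (t * i)%:E + (1 - t * s ^+ 2 + 4 * t ^+ 2 * s ^+ 4)%:E)%E.
    apply: (@le_trans _ _ ((t * i)%:E + \int[P]_w (expR (- t * Y w ^+ 2))%:E)%E); last first.
      by rewrite leeD2l// (le_trans (mom _ nt))// mulNr sqrrN.
    rewrite EFinM -iE -ge0_integralZl//; last 3 first.
    - by apply/measurable_EFinP.
    - by move=> w _; rewrite lee_fin sqr_ge0.
    - by rewrite lee_fin ltW.
    rewrite -ge0_integralD//; last 3 first.
    - by move=> w _; rewrite -EFinM lee_fin mulr_ge0 ?sqr_ge0// ltW.
    - by apply/measurable_EFinP; exact: measurable_funM.
    - by apply/measurable_EFinP.
    rewrite -[leLHS](@probability_setT _ _ _ P) -[P _]mul1e -integral_cst//.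
    apply: ge0_le_integral => //.
    + apply/measurable_EFinP; apply: measurable_funD => //; exact: measurable_funM.
    + move=> w _; rewrite -EFinM -EFinD lee_fin.
      by have := expR_ge1Dx (- t * Y w ^+ 2); lra.
  rewrite -EFinD lee_fin => H.
  have : t * s ^+ 2 <= t * (i + t * (4 * s ^+ 4)) by nra.
  by rewrite ler_pM2l// => /le_trans; apply; rewrite lerD2l.
Qed.

(* [expR (t w^2)] is the average of [expR (sqrt (2 t) x w)] over a standard
   normal [x]: after exchanging the integrals only linear functionals of [W]
   remain under [P]. *)
Lemma decoupling (m : nat) (W : 'I_m -> T -> R) (v : 'I_m -> R) (t : R) :
  (forall i, measurable_fun setT (W i)) -> 0 <= t ->
  (forall i, 0 <= v i) -> (forall i, 2 * t * v i < 1) ->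
  (forall b : 'I_m -> R, (\int[P]_w (expR (\sum_i b i * W i w))%:E =
     (expR ((\sum_i b i ^+ 2 * v i) / 2))%:E)%E) ->
  (\int[P]_w (expR (t * \sum_i W i w ^+ 2))%:E =
     (\prod_i (Num.sqrt (1 - 2 * t * v i))^-1)%:E)%E.
Proof.
move=> mW t0 v0 tv lin.
(* Induction statement: the squares indexed by [s] remain, the others have become linear terms with
   coefficients [b]. Since [b] vanishes on [s], linearizing the next square sets a coefficient that
   was zero. *)
have main (s : seq 'I_m) (b : 'I_m -> R) : uniq s -> {in s, forall i, b i = 0} ->
  (\int[P]_w (expR (t * \sum_(i <- s) W i w ^+ 2 + \sum_i b i * W i w))%:E =
   (\prod_(i <- s) (Num.sqrt (1 - 2 * t * v i))^-1 *
     expR ((\sum_i b i ^+ 2 * v i) / 2))%:E)%E.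
  elim: s b => [|i s IHs] b.
    move=> _ _; rewrite big_nil mul1r -lin; apply: eq_integral => w _.
    by rewrite big_nil mulr0 add0r.
  rewrite /= => /andP[iNs us] b0.
  have bi : b i = 0 by apply: b0; rewrite mem_head.
  pose c := Num.sqrt (2 * t).
  have c2 : c ^+ 2 = 2 * t by rewrite sqr_sqrtr// mulr_ge0.
  pose b' (x : R) j := if j == i then c * x else b j.
  have b'W x w : \sum_j b' x j * W j w = c * x * W i w + \sum_j b j * W j w.
    rewrite (bigD1 i)//= [in RHS](bigD1 i)//= bi mul0r add0r /b' eqxx; congr +%R.
    by apply: eq_bigr => j /negbTE ->.
  have b'v x : \sum_j b' x j ^+ 2 * v j = 2 * t * x ^+ 2 * v i + \sum_j b j ^+ 2 * v j.
    rewrite (bigD1 i)//= [in RHS](bigD1 i)//= bi expr0n/= mul0r add0r /b' eqxx.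
    rewrite exprMn c2; congr +%R.
    by apply: eq_bigr => j /negbTE ->.
  pose F w := t * \sum_(j <- s) W j w ^+ 2 + \sum_j b j * W j w.
  have mF : measurable_fun setT F.
    apply: measurable_funD.
      apply: measurable_funM => //; apply: measurable_sum => j.
      exact: measurable_funX.
    by apply: measurable_sum => j; exact: measurable_funM.
  pose G (wx : T * measurableTypeR R) : \bar R :=
    (expR (c * W i wx.1 * wx.2 + F wx.1))%:E.
  have mG : measurable_fun setT G.
    apply/measurable_EFinP; apply: measurableT_comp => //.
    apply: measurable_funD; last by apply: measurableT_comp mF _.
    apply: measurable_funM; last exact: measurable_snd.
    apply: measurable_funM => //; exact: measurableT_comp (mW i) _.
  transitivity (\int[P]_w \int[normal_prob 0 1]_x G (w, x))%E.
    apply: eq_integral => w _; rewrite /G/=.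
    under [RHS]eq_integral do rewrite expRD EFinM muleC.
    rewrite ge0_integralZl ?lee_fin ?expR_ge0//; last first.
      exact: measurable_expR_linear.
    rewrite normal_prob_mgf ?oner_neq0// -EFinM -expRD big_cons; congr ((expR _)%:E).
    by rewrite exprMn c2 /F expr1n; field.
  rewrite fubini_tonelli//; last by move=> x; rewrite lee_fin expR_ge0.
  (* For fixed [x] the integral under [P] depends on [x] only through [expR (t * v i * x ^+ 2)],
     whose average over [x] is the factor of index [i]. *)
  transitivity (\int[normal_prob 0 1]_x
      ((\prod_(j <- s) (Num.sqrt (1 - 2 * t * v j))^-1 *
        expR ((\sum_j b j ^+ 2 * v j) / 2))%:E * (expR (t * v i * x ^+ 2))%:E))%E.
    apply: eq_integral => x _; rewrite /G/=.
    transitivity (\int[P]_w (expR (t * \sum_(j <- s) W j w ^+ 2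
        + \sum_j b' x j * W j w))%:E)%E.
      by apply: eq_integral => w _; rewrite b'W /F; congr ((expR _)%:E); ring.
    rewrite IHs//; last first.
      move=> j js; rewrite /b'; case: eqP => [ji|_]; first by rewrite -ji js in iNs.
      by apply: b0; rewrite in_cons js orbT.
    by rewrite b'v -EFinM -[X in _ = X%:E]mulrA -expRD; congr ((_ * expR _)%:E); field.
  rewrite ge0_integralZl//; last 2 first.
  - exact: measurable_expR_sqr.
  - rewrite lee_fin mulr_ge0 ?expR_ge0//; apply: prodr_ge0 => j _.
    by rewrite invr_ge0 sqrtr_ge0.
  rewrite normal_prob_sqr_mgf ?oner_neq0//; last by rewrite expr1n mulr1 mulrA.
  rewrite -EFinM expr1n mulr1 mulrA big_cons; congr (_%:E); ring.
have := main (index_enum 'I_m) (fun=> 0) (index_enum_uniq _) (fun _ _ => erefl).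
rewrite [X in expR X](_ : _ = 0); last first.
  by rewrite big1 ?mul0r// => i _; rewrite expr0n/= mul0r.
rewrite expR0 mulr1 => <-; apply: eq_integral => w _.
by rewrite [X in _ + X]big1 ?addr0// => i _; rewrite mul0r.
Qed.

End GaussianChaos.

(** * Exponential moment of the squared norm of a Gaussian vector *)

Section QuadraticForm.
Context {R : realType}.

(** Concavity between [1 - u] and [1], with weight [l]. Taken with [l = v i / V], it bounds a
    product over the eigenvalues by an expression in their sum. *)
Lemma ln_1sub_scale (l u : R) : 0 <= l <= 1 -> 0 <= u < 1 ->
  l * ln (1 - u) <= ln (1 - l * u).
Proof.
move=> /andP[l0 l1] /andP[u0 u1].
have u1' : 0 < 1 - u by rewrite subr_gt0.
have := concave_ln (Itv01 l0 l1) u1' (@ltr01 R).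
rewrite !convRE/= ln1 mulr0 addr0 mulr1 => /le_trans; apply.
rewrite le_eqVlt; apply/orP; left; apply/eqP; congr ln.
by rewrite /unstable.onem; ring.
Qed.

Lemma inv_sqrt_expR (y : R) : 0 < y -> (Num.sqrt y)^-1 = expR (- (ln y / 2)).
Proof.
by move=> y0; rewrite -powR12_sqrt ?ltW// expRN /powR gt_eqF// mulrC.
Qed.

Context d (T : measurableType d) (P : probability T R).
Variables (m : nat) (Z : 'I_m -> T -> R).
Hypothesis mZ : forall i, measurable_fun setT (Z i).
Hypothesis gaussZ : centered_gaussian_process P Z.

Let lin (a : 'I_m -> R) w := \sum_i a i * Z i w.

Let mlin a : measurable_fun setT (lin a).
Proof. by apply: measurable_sum => i; exact: measurable_funM. Qed.

(** The hypothesis supplies an anonymous standard deviation for each combination. Its square is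
    identified here with the second moment, so that the covariance determines the exponential
    moments of all linear forms. *)
Let lin_sqr_fin a : exists2 q : R,
  (\int[P]_w (lin a w ^+ 2)%:E = q%:E)%E &
  (\int[P]_w (expR (lin a w))%:E = (expR (q / 2))%:E)%E.
Proof.
have [s s0 law] := gaussZ a; exists (s ^+ 2).
  exact: normal_law_sqr (mlin a) law.
have := normal_law_mgf (mlin a) law 1.
by rewrite expr1n mul1r => <-; apply: eq_integral => w _; rewrite mul1r.
Qed.

Let delta1 (i : 'I_m) : 'I_m -> R := fun j => (j == i)%:R.

Let lin_delta i w : lin (delta1 i) w = Z i w.
Proof.
rewrite /lin (bigD1 i)//= /delta1 eqxx mul1r big1 ?addr0// => j /negbTE ->.
by rewrite mul0r.
Qed.

Let Zsqr_integrable i : P.-integrable setT (fun w => (Z i w ^+ 2)%:E).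
Proof.
apply/integrableP; split; first by apply/measurable_EFinP; exact: measurable_funX.
have [q qE _] := lin_sqr_fin (delta1 i).
rewrite (_ : (\int[P]_w _)%E = q%:E) ?ltry// -qE; apply: eq_integral => w _.
by rewrite lin_delta /= ger0_norm// sqr_ge0.
Qed.

Let ZZ_integrable i j : P.-integrable setT (fun w => (Z i w * Z j w)%:E).
Proof.
apply: (@le_integrable _ _ _ _ _ measurableT _ (fun w => ((Z i w ^+ 2)%:E + (Z j w ^+ 2)%:E)%E)).
- by apply/measurable_EFinP; exact: measurable_funM.
- move=> w _; rewrite -EFinD/= lee_fin normrM.
  rewrite [X in _ <= X]ger0_norm ?addr_ge0 ?sqr_ge0//.
  rewrite -(real_normK (num_real (Z i w))) -(real_normK (num_real (Z j w))).
  have := normr_ge0 (Z i w); have := normr_ge0 (Z j w).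
  by move: `|Z i w| `|Z j w| => x y; nra.
- by apply: (integrableD measurableT (Zsqr_integrable i) (Zsqr_integrable j)).
Qed.

Let cov := \matrix_(i < m, j < m) fine (\int[P]_w (Z i w * Z j w)%:E)%E.

Let covE i j : (\int[P]_w (Z i w * Z j w)%:E = (cov i j)%:E)%E.
Proof. by rewrite mxE fineK//; exact: integrable_fin_num (ZZ_integrable i j). Qed.

Let cov_sym : cov^T = cov.
Proof.
apply/matrixP => i j; rewrite !mxE; congr fine; apply: eq_integral => w _.
by rewrite mulrC.
Qed.

Let lin_sqrE (a : 'rV[R]_m) :
  (\int[P]_w (lin (a 0) w ^+ 2)%:E = ((a *m cov *m a^T) 0 0)%:E)%E.
Proof.
transitivity (\int[P]_w (\sum_(p : 'I_m * 'I_m)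
    (a 0 p.1 * a 0 p.2)%:E * (Z p.1 w * Z p.2 w)%:E))%E.
  apply: eq_integral => w _; under eq_bigr do rewrite -EFinM.
  rewrite sumEFin expr2 /lin big_distrlr/= pair_bigA/=; congr (_%:E).
  by apply: eq_bigr => p _; rewrite mulrACA.
rewrite integral_sum//; last first.
  by move=> p; apply: integrableZl => //; exact: ZZ_integrable.
transitivity (\sum_(p : 'I_m * 'I_m) (a 0 p.1 * a 0 p.2 * cov p.1 p.2)%:E)%E.
  apply: eq_bigr => p _; rewrite (integralZl measurableT (ZZ_integrable _ _)).
  by rewrite covE -EFinM.
rewrite sumEFin; congr (_%:E); rewrite mxE.
rewrite (eq_bigr (fun j => \sum_i a 0 i * a 0 j * cov i j)); last first.
  move=> j _; rewrite !mxE mulr_suml; apply: eq_bigr => i _; ring.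
by rewrite exchange_big pair_bigA.
Qed.

(** The operator bound [V] fixes the admissible scale of the exponent, while the trace bound [tau]
    enters linearly: this is why [Q4] and [Q3] appear separately in [lambda]. *)
Lemma gaussian_sqnorm_mgf_le (V tau u : R) : 0 < V -> 0 <= u < 1 ->
  (forall a : 'I_m -> R, \sum_i a i ^+ 2 <= 1 ->
    (\int[P]_w ((\sum_i a i * Z i w) ^+ 2)%:E <= V%:E)%E) ->
  (\sum_i \int[P]_w (Z i w ^+ 2)%:E <= tau%:E)%E ->
  (\int[P]_w (expR (u / (2 * V) * \sum_i Z i w ^+ 2))%:E <=
    (expR (- (tau / (2 * V) * ln (1 - u))))%:E)%E.
Proof.
move=> V0 /andP[u0 u1] opV trV.
have [ O OO diagO] := symmetric_diagonalization cov_sym.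
have OTO : O^T *m O = 1%:M by apply: mulmx1C.
(* The variance of [W i], the [i]-th coordinate of [Z] in the eigenbasis formed by the rows of
   [O]. *)
pose v i := (O *m cov *m O^T) i i.
have quadE (b : 'rV[R]_m) : (b *m O *m cov *m (b *m O)^T) 0 0 = \sum_i b 0 i ^+ 2 * v i.
  rewrite [_ *m _](_ : _ = b *m (O *m cov *m O^T) *m b^T); last first.
    by rewrite trmx_mul !mulmxA.
  rewrite mxE; apply: eq_bigr => i _; rewrite mxE (bigD1 i)//= big1 ?addr0.
    by rewrite [b^T _ _]mxE /v; ring.
  by move=> j ji; rewrite ((is_diag_mxP diagO) j i) ?mulr0.
pose W i w := lin (row i O 0) w.
have WE (b : 'rV[R]_m) w : \sum_i b 0 i * W i w = lin ((b *m O) 0) w.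
  rewrite /W /lin; under eq_bigr do rewrite mulr_sumr.
  rewrite exchange_big; apply: eq_bigr => k _; rewrite mxE mulr_suml.
  by apply: eq_bigr => i _; rewrite mxE mulrA.
have W2E i : (\int[P]_w (W i w ^+ 2)%:E = (v i)%:E)%E.
  rewrite /W lin_sqrE rowE quadE (bigD1 i)//= big1 => [|j /negbTE ji].
    by rewrite mxE !eqxx expr1n mul1r addr0.
  by rewrite mxE ji andbF expr0n/= mul0r.
have normW w : \sum_i W i w ^+ 2 = \sum_i Z i w ^+ 2.
  pose x : 'cV[R]_m := \col_i Z i w.
  have sqE (y : 'cV[R]_m) : (y^T *m y) 0 0 = \sum_i y i 0 ^+ 2.
    by rewrite mxE; apply: eq_bigr => i _; rewrite mxE expr2.
  transitivity (((O *m x)^T *m (O *m x)) 0 0).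
    rewrite sqE; apply: eq_bigr => i _; congr (_ ^+ 2).
    by rewrite mxE; apply: eq_bigr => k _; rewrite !mxE.
  rewrite trmx_mul mulmxA -(mulmxA _ O^T) OTO mulmx1 sqE.
  by apply: eq_bigr => i _; rewrite mxE.
have v0 i : 0 <= v i.
  by rewrite -lee_fin -W2E; apply: integral_ge0 => w _; rewrite lee_fin sqr_ge0.
(* The rows of [O] are unit vectors, hence admissible coefficients in [opV]. *)
have vV i : v i <= V.
  rewrite -lee_fin -W2E; apply: opV.
  suff -> : \sum_k row i O 0 k ^+ 2 = (O *m O^T) i i by rewrite OO mxE eqxx.
  by rewrite mxE; apply: eq_bigr => k _; rewrite !mxE expr2.
have vtau : \sum_i v i <= tau.
  have -> : \sum_i v i = \sum_i cov i i.
    have -> : \sum_i v i = \tr (O *m cov *m O^T) by [].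
    by rewrite mxtrace_mulC mulmxA OTO mul1mx.
  rewrite -lee_fin -sumEFin; apply: le_trans trV; apply: lee_sum => i _.
  by rewrite -covE.
pose t := u / (2 * V).
have tE i : 2 * t * v i = v i / V * u by rewrite /t; field; rewrite gt_eqF.
have lV i : 0 <= v i / V <= 1.
  by apply/andP; split; [exact: divr_ge0 (ltW V0)|rewrite ler_pdivrMr// mul1r].
have t1 i : 2 * t * v i < 1.
  rewrite tE; case/andP: (lV i) => l0 l1; apply: le_lt_trans u1.
  by rewrite ler_piMl.
have t0 : 0 <= t by rewrite divr_ge0// mulr_ge0// ltW.
under eq_integral do rewrite -normW.
rewrite (@decoupling _ _ _ P m W v t)//; first last.
- move=> b; have [q] := lin_sqr_fin ((\row_i b i *m O) 0).
  rewrite lin_sqrE quadE => -[qE] mgfE.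
  have -> : \sum_i b i ^+ 2 * v i = q.
    by rewrite -qE; apply: eq_bigr => i _; rewrite mxE.
  rewrite -mgfE; apply: eq_integral => w _; rewrite -WE; congr (expR _)%:E.
  by apply: eq_bigr => i _; rewrite mxE.
- by move=> i; exact: mlin.
rewrite lee_fin (@le_trans _ _ (\prod_i expR (- (v i / (2 * V) * ln (1 - u)))))//.
  apply: ler_prod => i _; rewrite invr_ge0 sqrtr_ge0/= inv_sqrt_expR ?subr_gt0//.
  rewrite ler_expR lerN2 tE ler_pdivlMr//.
  have -> : v i / (2 * V) * ln (1 - u) * 2 = v i / V * ln (1 - u).
    by field; rewrite gt_eqF.
  by apply: ln_1sub_scale => //; rewrite u0 u1.
rewrite -expR_sum ler_expR sumrN lerN2 -!mulr_suml ler_wnM2r//.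
  by rewrite ln_le0// gerBl.
by rewrite ler_pM2r// invr_gt0 mulr_gt0.
Qed.

End QuadraticForm.

(** * Chernoff bound for the truncated energy of a block *)

Section BlockTail.
Context {R : realType} d (T : measurableType d) (P : probability T R).

Lemma expectation_integral (f : T -> R) : ('E_P[f] = \int[P]_w (f w)%:E)%E.
Proof. by rewrite unlock. Qed.

(** Two exponents are used because the tail is weighted by the sum of squares [S]: the exponential
    moment is taken at [u0], the event is tilted at [u1], and the excess [u0 - u1] absorbs [S]
    through [x <= expR x], at the price of the factor [2 * V / (u0 - u1)]. *)
Lemma block_tail_le (I : finType) (Z : I -> {RV P >-> R}) (U : {set I})
    (V tau Theta u0 u1 : R) :
  centered_gaussian_process P (fun i w => Z i w) ->
  0 < V -> 0 <= u1 -> u1 < u0 -> u0 < 1 ->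
  (forall a : I -> R, \sum_(k in U) a k ^+ 2 <= 1 ->
    ('E_P[fun w => ((\sum_(k in U) a k * Z k w) ^+ 2)%R] <= V%:E)%E) ->
  (\sum_(k in U) 'E_P[fun w => (Z k w ^+ 2)%R] <= tau%:E)%E ->
  (\sum_(k in U) 'E_P[fun w => (Z k w ^+ 2 *
      \1_[set w' | Theta < \sum_(k' in U) Z k' w' ^+ 2] w)%R] <=
    (2 * V / (u0 - u1) *
     expR (- (u1 * Theta / (2 * V) + tau / (2 * V) * ln (1 - u0))))%:E)%E.
Proof.
move=> gaussZ V0 u1_ge0 u10 u01 opV trV.
pose m := #|U|; pose Z' (i : 'I_m) w := Z (enum_val i) w.
have mZ' i : measurable_fun setT (Z' i) by [].
(* Extension by zero outside [U]: it carries coefficients on the enumeration of [U] back to [I],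
   where the hypotheses are stated. *)
pose ext (a : 'I_m -> R) k := \sum_(i | enum_val i == k) a i.
have extE a i : ext a (enum_val i) = a i.
  by rewrite /ext (big_pred1 i)// => j; rewrite (inj_eq enum_val_inj).
have ext0 a k : k \notin U -> ext a k = 0.
  move=> kU; rewrite /ext big_pred0// => i; apply: contraNF kU => /eqP <-.
  exact: enum_valP.
have sumU (F : I -> R) : \sum_(k in U) F k = \sum_(i < m) F (enum_val i).
  exact: big_enum_val.
have sumZ a w : \sum_i a i * Z' i w = \sum_(k in U) ext a k * Z k w.
  by rewrite sumU; apply: eq_bigr => i _; rewrite extE.
have gaussZ' : centered_gaussian_process P Z'.
  move=> a; have [s s0 law] := gaussZ (ext a); exists s => // A mA.
  rewrite -law//; congr (P _); apply/seteqP.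
  suff E w : \sum_i a i * Z' i w = \sum_k ext a k * Z k w by split => w /=; rewrite E.
  rewrite sumZ [RHS](bigID (mem U))/= [X in _ + X]big1 ?addr0// => k /ext0 ->.
  by rewrite mul0r.
pose S w := \sum_(k in U) Z k w ^+ 2.
have S0 w : 0 <= S w by apply: sumr_ge0 => k _; rewrite sqr_ge0.
have mS : measurable_fun setT S.
  rewrite (_ : S = fun w => \sum_i Z' i w ^+ 2); last first.
    by apply/funext => w; rewrite /S sumU.
  by apply: measurable_sum => k; exact: measurable_funX.
have mI : measurable_fun setT (\1_[set w' | Theta < S w'] : T -> R).
  apply: measurable_indic; rewrite -[X in measurable X]setTI.
  have -> : [set w' | Theta < S w'] = S @^-1` `]Theta, +oo[%classic.
    by apply/seteqP; split => w /=; rewrite in_itv/= andbT.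
  exact: mS.
have u0_ge0 : 0 <= u0 by exact: ltW (le_lt_trans u1_ge0 u10).
have := @gaussian_sqnorm_mgf_le _ _ _ P m Z' mZ' gaussZ' V tau u0 V0.
rewrite u0_ge0 u01 => /(_ isT).
have opV' a : \sum_i a i ^+ 2 <= 1 ->
    (\int[P]_w ((\sum_i a i * Z' i w) ^+ 2)%:E <= V%:E)%E.
  move=> a1; under eq_integral do rewrite sumZ.
  have := opV (ext a); rewrite sumU (eq_bigr (fun i => a i ^+ 2)); last first.
    by move=> i _; rewrite extE.
  by move=> /(_ a1); rewrite expectation_integral.
have trV' : (\sum_i \int[P]_w (Z' i w ^+ 2)%:E <= tau%:E)%E.
  by move: trV; rewrite big_enum_val; under eq_bigr do rewrite expectation_integral.
move=> /(_ opV' trV') mgf.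
have eta0 : 0 < (u0 - u1) / (2 * V) by rewrite divr_gt0 ?subr_gt0// mulr_gt0.
pose c := 2 * V / (u0 - u1) * expR (- (u1 * Theta / (2 * V))).
have c0 : 0 <= c.
  by rewrite mulr_ge0 ?expR_ge0// divr_ge0 ?subr_ge0 ?ltW// mulr_gt0.
apply: (@le_trans _ _ (\int[P]_w (S w * \1_[set w' | (Theta < S w')%R] w)%:E)%E).
  under eq_bigr do rewrite expectation_integral.
  rewrite big_enum_val/= -ge0_integral_sum//; last 2 first.
  - by move=> k; apply/measurable_EFinP; apply: measurable_funM => //;
      exact: measurable_funX.
  - by move=> k w _; rewrite lee_fin mulr_ge0// sqr_ge0.
  rewrite le_eqVlt; apply/orP; left; apply/eqP; apply: eq_integral => w _.
  by rewrite sumEFin -mulr_suml /S sumU.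
apply: (@le_trans _ _ (\int[P]_w (c%:E * (expR (u0 / (2 * V) * S w))%:E))%E).
  apply: ge0_le_integral => //.
  - by move=> w _; rewrite lee_fin mulr_ge0.
  - by apply/measurable_EFinP; exact: measurable_funM.
  - apply/measurable_EFinP; apply: measurable_funM => //.
    by apply: measurableT_comp => //; exact: measurable_funM.
  - move=> w _; rewrite -EFinM lee_fin indicE.
    have [/set_mem/= ltS|_] := boolP (w \in _); last first.
      by rewrite mulr0 mulr_ge0 ?expR_ge0.
    rewrite mulr1 /c -[leRHS]mulrA -expRD.
    (* The exponent splits into a part that dominates [S] and a part that is nonnegative where
       [Theta < S]. *)
    have -> : - (u1 * Theta / (2 * V)) + u0 / (2 * V) * S w =
        (u0 - u1) / (2 * V) * S w + u1 / (2 * V) * (S w - Theta).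
      by field; rewrite gt_eqF.
    rewrite expRD mulrA -[leLHS]mulr1 ler_pM//; last first.
      by rewrite -[leLHS]expR0 ler_expR mulr_ge0 ?divr_ge0 ?subr_ge0 ?mulr_ge0// ltW.
    rewrite -[2 * V / _]invf_div ler_pdivlMl//.
    by apply: le_trans (expR_ge1Dx _); rewrite lerDr.
rewrite ge0_integralZl ?lee_fin//; last first.
  apply/measurable_EFinP; apply: measurableT_comp => //; exact: measurable_funM.
apply: (@le_trans _ _ (c%:E * (expR (- (tau / (2 * V) * ln (1 - u0))))%:E)%E).
  rewrite lee_wpmul2l ?lee_fin//; apply: le_trans mgf.
  rewrite le_eqVlt; apply/orP; left; apply/eqP; apply: eq_integral => w _.
  by rewrite /S sumU.
by rewrite -EFinM lee_fin /c -[leLHS]mulrA -expRD opprD.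
Qed.

End BlockTail.

(** * Scales and index sets *)

Section RealFacts.
Context {R : realType}.
Implicit Types (a b x y : R).

Lemma powR_expR a x : 0 < a -> a `^ x = expR (x * ln a).
Proof. by move=> a0; rewrite /powR gt_eqF. Qed.

Lemma powR2_log2 a x : 0 < a -> 2 `^ (x * log2 a) = a `^ x.
Proof.
move=> a0; rewrite !powR_expR// /log2; congr expR.
by rewrite -mulrA divfK// gt_eqF// ln_gt0// ltr1n.
Qed.

Lemma powRD_gt0 a x y : 0 < a -> a `^ (x + y) = a `^ x * a `^ y.
Proof. by move=> a0; rewrite powRD// (gt_eqF a0) implybT. Qed.

(* [u0] maximizes [u (1 + g)^2 + g^2 ln (1 - u)], with a value larger than [1]
   because [ln (1 + 1 / g) < 1 / g], and [u1] is slightly smaller. *)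
Lemma gaussian_gap (g : R) : 0 < g -> exists u0 u1 eps : R,
  [/\ 0 <= u1, u1 < u0, u0 < 1, 0 < eps &
      1 + eps <= u1 * (1 + g) ^+ 2 + g ^+ 2 * ln (1 - u0)].
Proof.
move=> g0; have g1 : 0 < 1 + g by lra.
pose G : R := 1 + 2 * g - 2 * g ^+ 2 * ln (1 + g^-1).
have G1 : 1 < G.
  have gi0 : g^-1 != 0 by rewrite gt_eqF// invr_gt0.
  have gi1 : 0 < 1 + g^-1 by rewrite addr_gt0// invr_gt0.
  have lng : ln (1 + g^-1) < g^-1.
    by rewrite -[ltRHS]expRK ltr_ln ?posrE ?expR_gt0// expR_gt1Dx.
  have : 2 * g ^+ 2 * ln (1 + g^-1) < 2 * g ^+ 2 * g^-1.
    by rewrite ltr_pM2l// mulr_gt0// exprn_gt0.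
  have -> : 2 * g ^+ 2 * g^-1 = 2 * g by field; rewrite gt_eqF.
  by rewrite /G; lra.
pose u0 : R := 1 - g ^+ 2 / (1 + g) ^+ 2.
have lnu : ln (1 - u0) = - (2 * ln (1 + g^-1)).
  have -> : 1 - u0 = (1 + g^-1) ^- 2.
    have -> : 1 + g^-1 = (1 + g) / g by rewrite mulrDl mul1r divff ?gt_eqF// addrC.
    by rewrite /u0 opprB addrC subrK -exprVn invf_div expr_div_n.
  by rewrite lnV ?posrE ?exprn_gt0 ?addr_gt0 ?invr_gt0// lnXn ?addr_gt0 ?invr_gt0// mulr_natl.
have u0g : u0 * (1 + g) ^+ 2 = 1 + 2 * g.
  by rewrite /u0; field; rewrite gt_eqF.
have u0_gt0 : 0 < u0.
  by rewrite -(ltr_pM2r (x := (1 + g) ^+ 2)) ?exprn_gt0// u0g mul0r; lra.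
pose k : R := Num.min (u0 / 2) ((G - 1) / 2 / (1 + g) ^+ 2).
have k0 : 0 < k.
  rewrite lt_min; apply/andP; split; first lra.
  by rewrite !divr_gt0 ?exprn_gt0 ?subr_gt0.
have ku0 : k <= u0 / 2 by rewrite ge_min lexx.
have kG : k * (1 + g) ^+ 2 <= (G - 1) / 2.
  by rewrite -ler_pdivlMr ?exprn_gt0// ge_min lexx orbT.
exists u0, (u0 - k), ((G - 1) / 2); split; [lra|lra| |lra|].
- by rewrite /u0 ltrBlDr ltrDl divr_gt0 ?exprn_gt0.
- have := u0g; have := lnu; rewrite /G in kG *; nra.
Qed.

Lemma bernoulli_le x m : -1 <= x -> 1 + m%:R * x <= (1 + x) ^+ m.
Proof.
move=> x1; elim: m => [|m IHm]; first by rewrite mul0r addr0 expr0.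
rewrite exprS -subr_ge0.
have := sqr_ge0 x; have : 0 <= (1 + x) * ((1 + x) ^+ m - (1 + m%:R * x)).
  by rewrite mulr_ge0; lra.
have m0 : 0 <= m%:R :> R by []. 
rewrite -natr1; nra.
Qed.

Lemma nat_powR_dvg b K : 0 < b -> \forall n \near \oo, K <= n%:R `^ b.
Proof.
move=> b0; near=> n.
have Kn : (`|K| + 1) `^ b^-1 <= n%:R by near: n; exact: nbhs_infty_ger.
have K0 : 0 <= `|K| + 1 by rewrite addr_ge0.
apply: (@le_trans _ _ (`|K| + 1)); first by rewrite (le_trans (ler_norm K))// lerDl.
have -> : `|K| + 1 = ((`|K| + 1) `^ b^-1) `^ b.
  by rewrite -powRrM mulVf ?gt_eqF// powRr1.
by rewrite ge0_ler_powR ?nnegrE ?powR_ge0// ltW.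
Unshelve. all: by end_near. Qed.

Lemma ln_nat_dvg K : \forall n \near \oo, K <= ln (n%:R : R).
Proof.
near=> n; have Kn : expR K <= n%:R by near: n; exact: nbhs_infty_ger.
by rewrite -[leLHS]expRK ler_ln ?posrE ?expR_gt0// (lt_le_trans _ Kn) ?expR_gt0.
Unshelve. all: by end_near. Qed.

Lemma ln_powR_dominated (r : R) a b : 0 <= r -> 0 <= a -> 0 < b ->
  \forall n \near \oo, (r * ln (n%:R : R)) `^ a <= n%:R `^ b.
Proof.
(* Half of the exponent [b] pays for the power of [n] that comes from [ln n <= n^e / e], the other
   half for the constant [(r / e)^a]. Using [a + 1] covers [a = 0]. *)
move=> r0 a0 b0; pose e := b / (2 * (a + 1)).
have e0 : 0 < e by rewrite divr_gt0// mulr_gt0//; lra.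
near=> n.
have n1 : (1 : R) <= n%:R by near: n; exact: nbhs_infty_ger.
have n0 : (0 : R) < n%:R by lra.
have K : (r / e) `^ a <= n%:R `^ (b / 2).
  by near: n; apply: nat_powR_dvg; lra.
have ln0 : 0 <= ln (n%:R : R) by rewrite ln_ge0.
have lnn : r * ln n%:R <= r / e * n%:R `^ e.
  rewrite -mulrA ler_wpM2l// ler_pdivlMl// -ln_powR.
  exact: ltW (ln_sublinear (powR_gt0 _ n0)).
have re0 : 0 <= r / e by rewrite divr_ge0// ltW.
apply: (@le_trans _ _ ((r / e * n%:R `^ e) `^ a)).
  by rewrite ge0_ler_powR// nnegrE mulr_ge0// ?powR_ge0.
rewrite powRM ?powR_ge0// -powRrM.
have -> : (n%:R : R) `^ b = n%:R `^ (b / 2) * n%:R `^ (b / 2).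
  by rewrite -powRD_gt0//; congr (_ `^ _); lra.
rewrite ler_pM ?powR_ge0// ler_powR// /e.
rewrite mulrAC ler_pdivrMr; [nra|lra].
Unshelve. all: by end_near. Qed.

(** * Geometric sums with a real cutoff *)

Section Geometric.
Variables (a X : R).
Hypotheses (a_gt0 : 0 < a) (X_gt0 : 0 < X).

Let rho : R := 2 `^ (- a).

Let rho_gt0 : 0 < rho. Proof. exact: powR_gt0. Qed.

Let rho_lt1 : rho < 1.
Proof.
have ln2 : 0 < ln 2 :> R by rewrite ln_gt0// ltr1n.
by rewrite /rho powR_expR// -[X in _ < X]expR0 ltr_expR mulNr oppr_lt0 mulr_gt0.
Qed.

Lemma geometric_ratio_gt0 : 0 < (1 - 2 `^ (- a))^-1.
Proof. by rewrite invr_gt0 subr_gt0. Qed.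

Let pow2S (j : nat) : rho * 2 `^ (j.+1%:R * a) = 2 `^ (j%:R * a).
Proof.
by rewrite /rho -powRD ?pnatr_eq0 ?implybT// -natr1; congr (_ `^ _); ring.
Qed.

Let pow2NS (j : nat) : 2 `^ (- (j.+1%:R * a)) = rho * 2 `^ (- (j%:R * a)).
Proof.
by rewrite /rho -powRD ?pnatr_eq0 ?implybT// -natr1; congr (_ `^ _); ring.
Qed.

Let pow2X (j : nat) : (2 `^ (j%:R * a) <= X `^ a) = (2 `^ j%:R <= X).
Proof.
rewrite powRrM; apply/idP/idP => [|h]; last first.
  by rewrite ge0_ler_powR ?nnegrE ?powR_ge0// ltW.
apply: contraTT; rewrite -!ltNge => h.
by rewrite gt0_ltr_powR ?nnegrE ?powR_ge0// ltW.
Qed.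

(** The cutoff is a condition on [2^j] and not a bound on [j]: real cutoffs are then used without
    rounding, and the bound is uniform in [N]. *)
Lemma geometric_sum_le (N : nat) :
  \sum_(j < N | 2 `^ j%:R <= X) 2 `^ (j%:R * a) <= (1 - 2 `^ (- a))^-1 * X `^ a.
Proof.
have C0 : 0 < 1 - rho by rewrite subr_gt0.
(* Both bounds go through the induction together: the second one controls the sum by the term about
   to be added, which gives the first one after the addition. *)
suff : (1 - rho) * \sum_(j < N | 2 `^ j%:R <= X) 2 `^ (j%:R * a) <= X `^ a /\
    (1 - rho) * \sum_(j < N | 2 `^ j%:R <= X) 2 `^ (j%:R * a) <= rho * 2 `^ (N%:R * a).
  by case=> h _; rewrite -/rho ler_pdivlMl.
elim: N => [|N [IHX IHN]].
  by rewrite big_ord0 mulr0 powR_ge0 mulr_ge0 ?powR_ge0.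
rewrite pow2S big_mkcond big_ord_recr/= -big_mkcond/=.
have y0 : 0 < 2 `^ (N%:R * a) :> R by exact: powR_gt0.
case: ifPn => NX.
  have : (1 - rho) * (\sum_(j < N | 2 `^ j%:R <= X) 2 `^ (j%:R * a) + 2 `^ (N%:R * a))
    <= 2 `^ (N%:R * a) by nra.
  by move=> h; split => //; apply: le_trans h _; rewrite pow2X.
rewrite addr0; split => //; apply: le_trans IHN _.
by rewrite ler_piMl ?ltW.
Qed.

Lemma geometric_tail_le (N : nat) :
  \sum_(j < N | X < 2 `^ j%:R) 2 `^ (- (j%:R * a)) <=
    (1 - 2 `^ (- a))^-1 * X `^ (- a).
Proof.
have C0 : 0 < 1 - rho by rewrite subr_gt0.
have Xa0 : 0 < X `^ (- a) by exact: powR_gt0.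
rewrite -/rho ler_pdivlMl//.
(* The right-hand side is zero as long as [2^N] has not passed [X], when the sum is empty, and
   telescopes afterwards; the minimum joins the two regimes. *)
suff : (1 - rho) * \sum_(j < N | X < 2 `^ j%:R) 2 `^ (- (j%:R * a)) <=
    X `^ (- a) - Num.min (X `^ (- a)) (2 `^ (- (N%:R * a))).
  move=> /le_trans; apply; rewrite gerBl le_min powR_ge0 ltW//.
elim: N => [|N IHN].
  by rewrite big_ord0 mulr0 subr_ge0 ge_min lexx.
rewrite big_mkcond big_ord_recr/= -big_mkcond/=.
have y0 : 0 < 2 `^ (- (N%:R * a)) :> R by exact: powR_gt0.
case: ifPn => [|]; rewrite ?ltNge -pow2X ?negbK -?ltNge => NX.
  have yX : 2 `^ (- (N%:R * a)) <= X `^ (- a).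
    by rewrite !powRN lef_pV2 ?posrE ?powR_gt0// ltW.
  rewrite (min_idPr yX) in IHN; rewrite pow2NS.
  have : Num.min (X `^ (- a)) (rho * 2 `^ (- (N%:R * a))) <= rho * 2 `^ (- (N%:R * a)).
    by rewrite ge_min lexx orbT.
  by move: (Num.min _ _) => z zN; rewrite mulrDr; nra.
have yX : X `^ (- a) <= 2 `^ (- (N%:R * a)).
  by rewrite !powRN lef_pV2 ?posrE ?powR_gt0.
rewrite (min_idPl yX) subrr in IHN; rewrite addr0 (le_trans IHN)//.
by rewrite subr_ge0 ge_min lexx.
Qed.

End Geometric.

End RealFacts.

(** * Cardinalities of levels and blocks *)

Section IndexCounts.
Context {R : realType} {d : nat}.
Variables (mu : 'I_d -> R) (c upsilon r delta : R) (n : nat).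

Lemma prod_powR2 (j : nat) : \prod_i 2 `^ (mu i * j%:R) = 2 `^ (dstar mu * j%:R).
Proof.
under eq_bigr do rewrite powR_expR//.
by rewrite -expR_sum powR_expR// /dstar !mulr_suml.
Qed.

Lemma card_B_le (j : nat) : 0 <= c -> #|B c upsilon j|%:R <= c * 2 `^ (upsilon * j%:R).
Proof. by move=> c0; rewrite card_ord truncn_le mulr_ge0// powR_ge0. Qed.

Lemma card_dffun_ord (s : 'I_d -> nat) :
  #|{dffun forall i : 'I_d, 'I_(s i)}| = (\prod_i s i)%N.
Proof.
have := card_family (fun i : 'I_d => predT : pred 'I_(s i)).
rewrite foldrE big_image/=.
under eq_bigr do rewrite card_ord.
by move=> <-; apply: eq_card => k; symmetry; apply/familyP.
Qed.

Lemma card_D_le (j : nat) : #|D mu j|%:R <= 2 `^ (dstar mu * j%:R) :> R.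
Proof.
rewrite card_dffun_ord natr_prod -prod_powR2; apply: ler_prod => i _.
by rewrite ler0n truncn_le powR_ge0.
Qed.

Lemma card_A_le (j : nat) :
  #|A mu r n j|%:R <= 2 `^ (dstar mu * j%:R) / (L d r n)%:R ^+ d :> R.
Proof.
rewrite card_dffun_ord natr_prod -prod_powR2.
have -> : (L d r n)%:R ^- d = \prod_(i < d) (L d r n)%:R^-1 :> R.
  by rewrite prodr_const card_ord exprVn.
rewrite -big_split; apply: ler_prod => i _.
by rewrite ler0n truncn_le divr_ge0 ?powR_ge0.
Qed.

Lemma card_U_le (j : nat) (K : A mu r n j) : (#|U K| <= L d r n ^ d)%N.
Proof.
pose F i := [pred x : 'I_(side mu j i) | (K i * L d r n <= x < (K i).+1 * L d r n)%N].
have -> : #|U K| = #|(family F : simpl_pred {dffun forall i : 'I_d, 'I_(side mu j i)})|.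
  by apply: eq_card => k; rewrite inE; apply/forallP/familyP.
rewrite card_family foldrE big_image/=.
rewrite -[X in (_ <= _ ^ X)%N]card_ord -prod_nat_const; apply: leq_prod => i _.
rewrite cardE -(size_map val) -[leqRHS](size_iota (K i * L d r n)).
apply: uniq_leq_size.
  by rewrite map_inj_uniq ?enum_uniq//; exact: val_inj.
move=> _ /mapP[x + ->]; rewrite mem_enum mem_iota [(_ + L d r n)%N]addnC -mulSn.
by rewrite unfold_in.
Qed.

Lemma U_disjoint (j : nat) (K K' : A mu r n j) (k : D mu j) :
  k \in U K -> k \in U K' -> K = K'.
Proof.
rewrite !inE => /forallP kK /forallP kK'; apply/ffunP => i; apply/val_inj.
have /andP[h1 h2] := kK i; have /andP[h3 h4] := kK' i.
apply/eqP; rewrite eqn_leq; apply/andP; split; rewrite -ltnS.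
  by have := leq_ltn_trans h1 h4; rewrite ltn_mul2r => /andP[].
by have := leq_ltn_trans h3 h2; rewrite ltn_mul2r => /andP[].
Qed.

End IndexCounts.

(** * Size of the block length and of the extreme scales *)

Section Scales.
Context {R : realType} (d : nat) (r : R).
Hypotheses (d_gt0 : (0 < d)%N) (r_gt0 : 0 < r).

Lemma L_pow_le n : 0 <= ln (n%:R : R) -> (L d r n)%:R ^+ d <= r * ln n%:R.
Proof.
move=> ln0; have rln : 0 <= r * ln (n%:R : R) by rewrite mulr_ge0// ltW.
set y := r * ln n%:R in rln *.
have -> : y = (y `^ d%:R^-1) ^+ d.
  by rewrite -powR_mulrn ?powR_ge0// -powRrM mulVf ?powRr1// pnatr_eq0 -lt0n.
by rewrite lerXn2r ?nnegrE ?powR_ge0// truncn_le powR_ge0.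
Qed.

(** Rounding in [L] costs an arbitrarily small factor, which the gain [eps] of [gaussian_gap] will
    pay. By Bernoulli's inequality, lowering [x] by [1] multiplies [x ^+ d] by at least
    [1 - d / x]. *)
Lemma L_pow_ge (eps : R) : 0 < eps ->
  \forall n \near \oo, r * ln (n%:R : R) <= (1 + eps) * (L d r n)%:R ^+ d.
Proof.
(* For [x] beyond [y] the product [(1 + eps) (1 - d / x)] is at least [1]; the leading [1] ensures
   [1 <= x] for Bernoulli's inequality. *)
move=> eps0; pose y : R := 1 + d%:R * (1 + eps) / eps.
have y1 : 1 <= y by rewrite lerDl divr_ge0 ?mulr_ge0//; lra.
near=> n; have lny : y ^+ d / r <= ln (n%:R : R) by near: n; exact: ln_nat_dvg.
have yr : y ^+ d <= r * ln (n%:R : R) by rewrite -ler_pdivrMl// mulrC.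
have rln : 0 <= r * ln (n%:R : R) by rewrite (le_trans _ yr)// exprn_ge0//; lra.
pose x : R := (r * ln n%:R) `^ d%:R^-1.
have xd : x ^+ d = r * ln n%:R.
  by rewrite /x -powR_mulrn ?powR_ge0// -powRrM mulVf ?powRr1// pnatr_eq0 -lt0n.
have x0 : 0 <= x by exact: powR_ge0.
have yx : y <= x by rewrite -(ler_pXn2r d_gt0) ?nnegrE ?xd//; lra.
have Lx : x - 1 <= (L d r n)%:R.
  by have /andP[_] := truncn_itv x0; rewrite -natr1 -/x /L; lra.
have x_gt0 : 0 < x by lra.
have bern : 1 + d%:R * (- x^-1) <= (1 - x^-1) ^+ d.
  by apply: bernoulli_le; rewrite lerN2 invf_le1//; lra.
rewrite -xd; apply: (@le_trans _ _ ((1 + eps) * (x - 1) ^+ d)); last first.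
  by rewrite ler_wpM2l ?lerXn2r ?nnegrE//; lra.
have -> : x - 1 = x * (1 - x^-1) by rewrite mulrBr mulr1 divff// gt_eqF.
rewrite exprMn mulrCA ler_peMr ?exprn_ge0//.
apply: (@le_trans _ _ ((1 + eps) * (1 + d%:R * - x^-1))); last first.
  by rewrite ler_wpM2l//; lra.
have : d%:R * (1 + eps) / eps <= x by rewrite /y in yx; lra.
rewrite ler_pdivrMr// => h.
have : d%:R * (1 + eps) / x <= eps by rewrite ler_pdivrMr// [eps * x]mulrC.
have -> : (1 + eps) * (1 + d%:R * - x^-1) = 1 + eps - d%:R * (1 + eps) / x by ring.
by lra.
Unshelve. all: by end_near. Qed.

Lemma L_ge1 : \forall n \near \oo, (0 < L d r n)%N.
Proof.
near=> n; have ln1 : r^-1 <= ln (n%:R : R) by near: n; exact: ln_nat_dvg.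
have rln : 1 <= r * ln (n%:R : R) by rewrite -ler_pdivrMl// mulr1.
rewrite truncn_gt0 -[leLHS](powRr0 (r * ln n%:R)) ler_powR// invr_ge0.
Unshelve. all: by end_near. Qed.

Variables (mu : 'I_d -> R).
Hypothesis mu_gt0 : forall i, 0 < mu i.

Lemma inf_range_ge0 : 0 <= inf (range mu).
Proof.
apply: lb_le_inf; first by exists (mu (Ordinal d_gt0)), (Ordinal d_gt0).
by move=> _ [i _ <-]; exact: ltW.
Qed.

Lemma pow2_j0_le n : (0 < L d r n)%N ->
  2 `^ (j0 mu r n)%:R <= (L d r n)%:R `^ (inf (range mu))^-1.
Proof.
move=> L0; rewrite -[leRHS]powR2_log2 ?ltr0n// ler_powR ?ler1n// truncn_le mulr_ge0//.
  by rewrite invr_ge0 inf_range_ge0.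
by rewrite /log2 divr_ge0 ?ln_ge0 ?ler1n.
Qed.

(** [2^j0] is at most a power of [L], itself at most a power of [ln n]: the coarse levels never cost
    a power of [n]. *)
Lemma j0_pow_dominated (a b : R) : 0 <= a -> 0 < b ->
  \forall n \near \oo, 2 `^ ((j0 mu r n)%:R * a) <= n%:R `^ b.
Proof.
move=> a0 b0; pose e : R := d%:R^-1 * (inf (range mu))^-1 * a.
have e0 : 0 <= e by rewrite !mulr_ge0 ?invr_ge0 ?inf_range_ge0.
near=> n; have L0 : (0 < L d r n)%N by near: n; exact: L_ge1.
have ln0 : 0 <= ln (n%:R : R) by near: n; exact: ln_nat_dvg.
have dom : (r * ln (n%:R : R)) `^ e <= n%:R `^ b.
  by near: n; apply: ln_powR_dominated => //; exact: ltW.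
apply: le_trans dom; rewrite powRrM /e [X in _ <= X]powRrM.
rewrite ge0_ler_powR ?nnegrE ?powR_ge0// powRrM.
apply: le_trans (pow2_j0_le L0) _.
rewrite ge0_ler_powR ?nnegrE ?powR_ge0 ?invr_ge0 ?inf_range_ge0//.
by rewrite truncn_le powR_ge0.
Unshelve. all: by end_near. Qed.

Lemma j0_le_J : \forall n \near \oo, (j0 mu r n <= J R n)%N.
Proof.
near=> n.
have n1 : (1 : R) <= n%:R by near: n; exact: nbhs_infty_ger.
have : 2 `^ ((j0 mu r n)%:R * 1) <= (n%:R : R) `^ 1.
  by near: n; exact: j0_pow_dominated.
have ln2 : 0 < ln 2 :> R by rewrite ln_gt0 ?ltr1n.
have n0 : (0 : R) < n%:R by lra.
rewrite mulr1 powRr1// powR_expR// -[leRHS](lnK n0) ler_expR => h.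
have log0 : 0 <= log2 (n%:R : R) by apply: divr_ge0; [exact: ln_ge0|exact: ltW].
by rewrite truncn_ge_nat// /log2 ler_pdivlMr.
Unshelve. all: by end_near. Qed.

(** The left inequality lets [n^(-r)] offset the geometric sum over the kept levels; the right one
    places the levels beyond [Jstar] above the scale at which their bias is measured. *)
Lemma pow2_Jstar (upsilon delta : R) n : (0 < n)%N ->
  0 < dstar mu + delta + upsilon ->
  2 `^ ((Jstar mu upsilon r delta n)%:R * (dstar mu + delta + upsilon)) <= n%:R `^ r
    < 2 `^ ((Jstar mu upsilon r delta n).+1%:R * (dstar mu + delta + upsilon)).
Proof.
move=> n0 s0; set s := _ + upsilon in s0 *.
have n0' : (0 : R) < n%:R by rewrite ltr0n.
have ln0 : 0 <= r / s * log2 (n%:R : R).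
  by rewrite mulr_ge0 ?divr_ge0 ?ln_ge0 ?ler1n// ltW.
have ln2 : 0 < ln 2 :> R by rewrite ln_gt0 ?ltr1n.
have -> : n%:R `^ r = 2 `^ (r / s * log2 n%:R * s) :> R.
  by rewrite mulrAC divfK ?gt_eqF// powR2_log2.
have /andP[h1 h2] := truncn_itv ln0.
rewrite !powR_expR// ler_expR ltr_expR; apply/andP; split.
  by rewrite ler_pM2r// ler_pM2r.
by rewrite ltr_pM2r// ltr_pM2r.
Qed.

End Scales.

(** * The noise conditions *)

Section EReal.
Context {R : realType}.

Lemma lee_pmul_divr (a b : R) (x : \bar R) : 0 < a ->
  (a%:E * x <= b%:E)%E -> (x <= (a^-1 * b)%:E)%E.
Proof.
move=> a0; case: x => [x| |].
- by rewrite -EFinM !lee_fin ler_pdivlMl.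
- by rewrite gt0_muley ?lte_fin.
- by rewrite leNye.
Qed.

Lemma sume_le_card (I : finType) (Q : pred I) (F : I -> \bar R) (b : R) :
  (forall i, Q i -> (F i <= b%:E)%E) ->
  (\sum_(i | Q i) F i <= (#|Q|%:R * b)%:E)%E.
Proof.
move=> Fb; apply: (@le_trans _ _ (\sum_(i | Q i) b%:E)%E); first exact: lee_sum.
by rewrite sumEFin sumr_const mulr_natl.
Qed.

End EReal.

(** * Moment bounds on levels and blocks, and the tail condition *)

Section NoiseBounds.
Context {R : realType} {d : nat}.
Variables (mu : 'I_d -> R) (c upsilon r delta : R) (n : nat).
Hypotheses (d_gt0 : (0 < d)%N) (r_gt0 : 0 < r) (c_ge0 : 0 <= c).
Context {disp : measure_display} {T : measurableType disp}
  {P : probability T R}.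
Variable z : level_family mu c upsilon {RV P >-> R}.
Variables (Q3 Q4 : R).
Hypotheses (Q3_gt0 : 0 < Q3) (Q4_gt0 : 0 < Q4).
Hypotheses (gauss : gaussian_noise n z) (z3 : A3 delta n z Q3) (z4 : A4 r delta n z Q4).

Lemma sqr_moment_le (Y : T -> R) (b : R) : measurable_fun setT Y -> 0 < b ->
  ('E_P[fun w => (Y w ^+ 4)%R] <= (b ^+ 2)%:E)%E ->
  ('E_P[fun w => (Y w ^+ 2)%R] <= b%:E)%E.
Proof.
move=> mY b0; rewrite !expectation_integral => Y4.
have mY4 : measurable_fun setT (fun w => (Y w ^+ 4)%:E : \bar R).
  by apply/measurable_EFinP; exact: measurable_funX.
(* AM-GM: [Y^2 <= Y^4 / (2 b) + b / 2] *)
apply: (@le_trans _ _ (\int[P]_w ((2 * b)^-1%:E * (Y w ^+ 4)%:E + (b / 2)%:E))%E).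
  apply: ge0_le_integral => //.
  - by move=> w _; rewrite lee_fin sqr_ge0.
  - by apply/measurable_EFinP; exact: measurable_funX.
  - apply/measurable_EFinP; apply: measurable_funD => //.
    by apply: measurable_funM => //; exact: measurable_funX.
  - move=> w _; rewrite -EFinM -EFinD lee_fin.
    rewrite -(ler_pM2l (_ : 0 < 2 * b)) ?mulr_gt0// mulrDr mulrA mulfV ?gt_eqF ?mulr_gt0// mul1r.
    have -> : 2 * b * (b / 2) = b ^+ 2 by field.
    by have := sqr_ge0 (Y w ^+ 2 - b); rewrite (exprM _ 2 2); nra.
have Y40 w : (0 <= (Y w ^+ 4)%:E)%E by rewrite lee_fin (exprM _ 2 2) sqr_ge0.
have b20 : 0 <= (2 * b)^-1 by rewrite invr_ge0 mulr_ge0// ltW.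
have p1 w : [set: T] w -> (0 <= (2 * b)^-1%:E * (Y w ^+ 4)%:E)%E by rewrite mule_ge0.
have p2 w : [set: T] w -> (0 <= (b / 2)%:E)%E by rewrite lee_fin divr_ge0// ltW.
have m1 : measurable_fun [set: T] (fun w => ((2 * b)^-1%:E * (Y w ^+ 4)%:E)%E).
  exact: emeasurable_funM.
rewrite (ge0_integralD P measurableT p1 m1 p2)//.
have -> : (\int[P]_w (b / 2)%:E = (b / 2)%:E)%E.
  by rewrite integral_cst//= probability_setT mule1.
have b20E : (0 <= (2 * b)^-1%:E)%E by rewrite lee_fin.
rewrite (ge0_integralZl P measurableT mY4 (fun w _ => Y40 w) b20E).
apply: (@le_trans _ _ ((2 * b)^-1%:E * (b ^+ 2)%:E + (b / 2)%:E)%E).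
  by rewrite leeD2r// lee_wpmul2l.
rewrite -EFinM -EFinD lee_fin le_eqVlt; apply/orP; left; apply/eqP.
by field; rewrite gt_eqF.
Qed.

Lemma noise_sqr_le (j : nat) (l : B c upsilon j) (k : D mu j) : (j <= J R n)%N ->
  ('E_P[fun w => (z l k w ^+ 2)%R] <= (Q3 `^ 2^-1 * 2 `^ (delta * j%:R))%:E)%E.
Proof.
move=> jJ; apply: sqr_moment_le => //; first by rewrite mulr_gt0 ?powR_gt0.
have := lee_pmul_divr (powR_gt0 _ (@ltr0n R 2)) (z3 jJ l k).
move=> /le_trans; apply; rewrite lee_fin le_eqVlt; apply/orP; left; apply/eqP.
rewrite -powRN opprK exprMn -!powR_mulrn ?powR_ge0// -!powRrM mulVf// powRr1 ?ltW//.
by rewrite mulrC; congr (_ * _ `^ _); ring.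
Qed.

Lemma noise_A1 : A1 delta n z (Q3 `^ 2^-1).
Proof.
move=> j jJ l; have := sume_le_card (fun (k : D mu j) (_ : true) => noise_sqr_le l k jJ).
move=> h; apply: (@le_trans _ _ ((2 `^ (- (j%:R * (dstar mu + delta))))%:E *
    (#|D mu j|%:R * (Q3 `^ 2^-1 * 2 `^ (delta * j%:R)))%:E)%E).
  by rewrite lee_wpmul2l ?lee_fin ?powR_ge0.
rewrite -EFinM lee_fin.
apply: (@le_trans _ _ (2 `^ (- (j%:R * (dstar mu + delta))) *
    (2 `^ (dstar mu * j%:R) * (Q3 `^ 2^-1 * 2 `^ (delta * j%:R))))).
  by rewrite ler_wpM2l ?powR_ge0// ler_wpM2r ?mulr_ge0 ?powR_ge0// card_D_le.
rewrite mulrCA [X in _ * X]mulrCA mulrCA -!powRD_gt0//.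
rewrite [X in 2 `^ X](_ : _ = 0) ?powRr0 ?mulr1//; ring.
Qed.

(** (A4) takes one family of coefficients for all levels and constrains it on every block. A vector
    given on one block is therefore extended by zero, both to the rest of its level and to the other
    levels. *)
Lemma block_operator_le (j : nat) (l : B c upsilon j) (K : A mu r n j) (a : D mu j -> R) :
  (j <= J R n)%N -> \sum_(k in U K) a k ^+ 2 <= 1 ->
  ('E_P[fun w => ((\sum_(k in U K) a k * z l k w) ^+ 2)%R] <=
     (Q4 * 2 `^ (delta * j%:R))%:E)%E.
Proof.
move=> jJ a1.
pose a' (k : D mu j) := if k \in U K then a k else 0.
pose f j' : D mu j' -> R := fun=> 0.
have fa_le1 j' (K' : A mu r n j') :
    \sum_(k in U K') (@eqtype.dfwith _ (fun j => D mu j -> R) f j a' j' k) ^+ 2 <= 1.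
  case: eqtype.dfwithP K' => [|i ji] K'; last by rewrite big1// => k _; rewrite expr0n.
  apply: le_trans a1; rewrite big_mkcond [leRHS]big_mkcond; apply: ler_sum => k _.
  rewrite /a'; case: ifP => _; case: ifP => _; rewrite ?expr0n ?sqr_ge0//=.
have := lee_pmul_divr (powR_gt0 _ (@ltr0n R 2))
  (z4 (fun j' _ K' => fa_le1 j' K') jJ l K).
rewrite -powRN opprK mulrC; congr (_ <= _)%E; rewrite !expectation_integral.
apply: eq_integral => w _; congr ((_ ^+ 2)%:E); apply: eq_bigr => k kU.
by rewrite eqtype.dfwith_in /a' kU.
Qed.

Lemma block_trace_le (j : nat) (l : B c upsilon j) (K : A mu r n j) : (j <= J R n)%N ->
  (\sum_(k in U K) 'E_P[fun w => (z l k w ^+ 2)%R] <=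
    ((L d r n)%:R ^+ d * (Q3 `^ 2^-1 * 2 `^ (delta * j%:R)))%:E)%E.
Proof.
move=> jJ; apply: le_trans (sume_le_card (fun k _ => noise_sqr_le l k jJ)) _.
rewrite lee_fin ler_wpM2r ?mulr_ge0 ?powR_ge0//.
by rewrite -natrX ler_nat; exact: card_U_le.
Qed.

Variables (u0 u1 eps : R).
(** In units of [2 * V] with [V = Q4 2^(delta j)], the trace bound of a block is [g^2 L^d] and the
    threshold in (A2) is [(1 + g)^2 L^d]: the level disappears from the exponent. *)
Let g : R := Q3 `^ 4^-1 / (2 * Q4) `^ 2^-1.
Hypotheses (u1_ge0 : 0 <= u1) (u10 : u1 < u0) (u01 : u0 < 1).
Hypothesis gap : 1 + eps <= u1 * (1 + g) ^+ 2 + g ^+ 2 * ln (1 - u0).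
Hypotheses (n_gt0 : (0 < n)%N) (L_gt0 : (0 < L d r n)%N).
Hypothesis L_large : r * ln (n%:R : R) <= (1 + eps) * (L d r n)%:R ^+ d.
Let lambda : R := 4 * ((2 * Q4) `^ 2^-1 + Q3 `^ 4^-1) ^+ 2.

Let g2 : g ^+ 2 = Q3 `^ 2^-1 / (2 * Q4).
Proof.
rewrite /g exprMn exprVn -!powR_mulrn ?powR_ge0// -!powRrM mulVf// powRr1; last first.
  by rewrite mulr_ge0// ltW.
by congr (_ `^ _ / _); field.
Qed.

Let lambdaE : lambda = 4 * (2 * Q4) * (1 + g) ^+ 2.
Proof.
have h0 : 0 < (2 * Q4) `^ 2^-1 by rewrite powR_gt0// mulr_gt0.
have h2 : ((2 * Q4) `^ 2^-1) ^+ 2 = 2 * Q4.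
  by rewrite -powR_mulrn ?powR_ge0// -powRrM mulVf// powRr1// mulr_ge0// ltW.
rewrite /lambda -[in RHS]h2 /g; field; rewrite gt_eqF//.
Qed.

Lemma block_tail_bound (j : nat) (l : B c upsilon j) (K : A mu r n j) : (j <= J R n)%N ->
  (\sum_(k in U K) 'E_P[fun w => (z l k w ^+ 2 *
        \1_[set w' | lambda * 2 `^ (delta * j%:R) * (L d r n)%:R ^+ d / 4
                     < \sum_(k' in U K) z l k' w' ^+ 2] w)%R]
   <= (2 * Q4 / (u0 - u1) * n%:R `^ (- r) * 2 `^ (delta * j%:R))%:E)%E.
Proof.
move=> jJ; set m := (L d r n)%:R ^+ d; set V := Q4 * 2 `^ (delta * j%:R).
have p0 : 0 < 2 `^ (delta * j%:R) :> R by exact: powR_gt0.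
have V0 : 0 < V by rewrite mulr_gt0.
apply: le_trans (block_tail_le _ (gauss jJ l) V0 u1_ge0 u10 u01
  (fun a a1 => block_operator_le l jJ a1) (block_trace_le l K jJ)) _.
rewrite lee_fin -/m -/V.
have -> : u1 * (lambda * 2 `^ (delta * j%:R) * m / 4) / (2 * V) = u1 * (1 + g) ^+ 2 * m.
  by rewrite lambdaE /V; field; rewrite !gt_eqF.
have -> : m * (Q3 `^ 2^-1 * 2 `^ (delta * j%:R)) / (2 * V) = g ^+ 2 * m.
  by rewrite g2 /V; field; rewrite !gt_eqF.
have -> : 2 * Q4 / (u0 - u1) * n%:R `^ (- r) * 2 `^ (delta * j%:R) =
    2 * V / (u0 - u1) * n%:R `^ (- r) by rewrite /V; ring.
rewrite ler_wpM2l ?divr_ge0 ?mulr_ge0 ?subr_ge0 ?(ltW u10) ?(ltW Q4_gt0) ?powR_ge0//.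
rewrite powR_expR ?ltr0n// ler_expR mulNr lerN2.
apply: le_trans L_large _; rewrite -/m.
have -> : u1 * (1 + g) ^+ 2 * m + g ^+ 2 * m * ln (1 - u0) =
  (u1 * (1 + g) ^+ 2 + g ^+ 2 * ln (1 - u0)) * m by ring.
by rewrite ler_wpM2r// exprn_ge0.
Qed.

Lemma noise_A2 : 0 < dstar mu + delta + upsilon -> (Jstar mu upsilon r delta n <= J R n)%N ->
  A2 r delta n z lambda (c * (2 * Q4 / (u0 - u1)) *
    (1 - 2 `^ (- (dstar mu + delta + upsilon)))^-1).
Proof.
move=> s0 JJ; set s := dstar mu + delta + upsilon in s0 *.
have : 0 <= 2 * Q4 / (u0 - u1) by rewrite divr_ge0 ?mulr_ge0 ?subr_ge0 ?(ltW u10) ?(ltW Q4_gt0).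
move CE : (2 * Q4 / (u0 - u1)) => C C0.
set N := Jstar mu upsilon r delta n in JJ *.
have L1 : 1 <= (L d r n)%:R ^+ d :> R by rewrite exprn_ege1// ler1n.
apply: (@le_trans _ _ (\sum_(j0 mu r n <= j < N.+1)
    (c * C * n%:R `^ (- r) * 2 `^ (j%:R * s))%:E)%E).
  rewrite big_nat [leRHS]big_nat; apply: lee_sum => j /andP[_ jN].
  have jJ : (j <= J R n)%N by rewrite (leq_trans _ JJ).
  set bj := C * n%:R `^ (- r) * 2 `^ (delta * j%:R).
  have bj0 : 0 <= bj by rewrite !mulr_ge0 ?powR_ge0.
  apply: le_trans (sume_le_card (fun l _ =>
    sume_le_card (fun K _ => block_tail_bound l K jJ))) _.
  rewrite lee_fin CE -/bj.
  apply: (@le_trans _ _ (c * 2 `^ (upsilon * j%:R) * (2 `^ (dstar mu * j%:R) * bj))).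
    apply: ler_pM; rewrite ?mulr_ge0//; first exact: card_B_le.
    rewrite ler_wpM2r//; apply: le_trans (card_A_le _ _ _ _) _.
    by rewrite ler_pdivrMr ?ler_peMr ?powR_ge0// (lt_le_trans _ L1).
  rewrite /bj le_eqVlt; apply/orP; left; apply/eqP.
  have -> : 2 `^ (j%:R * s) =
      2 `^ (upsilon * j%:R) * 2 `^ (dstar mu * j%:R) * 2 `^ (delta * j%:R) :> R.
    by rewrite -!powRD_gt0//; congr (_ `^ _); rewrite /s; ring.
  ring.
rewrite sumEFin lee_fin -mulr_sumr.
have X0 : 0 < 2 `^ N%:R :> R by exact: powR_gt0.
apply: (@le_trans _ _ (c * C * n%:R `^ (- r) *
    ((1 - 2 `^ (- s))^-1 * (2 `^ N%:R) `^ s))).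
  rewrite ler_wpM2l ?mulr_ge0 ?powR_ge0//.
  apply: le_trans (geometric_sum_le s0 X0 N.+1).
  rewrite big_geq_mkord big_mkcond [leRHS]big_mkcond; apply: ler_sum => j _.
  have -> : 2 `^ j%:R <= 2 `^ N%:R :> R by rewrite ler_powR ?ler1n// ler_nat -ltnS.
  by case: ifP => _ //; rewrite powR_ge0.
have /andP[hN _] := pow2_Jstar r_gt0 n_gt0 s0.
have -> : c * C * (1 - 2 `^ (- s))^-1 =
   c * C * n%:R `^ (- r) * ((1 - 2 `^ (- s))^-1 * n%:R `^ r).
  have nn : n%:R `^ (- r) * n%:R `^ r = 1 :> R.
    by rewrite -powRD_gt0 ?ltr0n// addNr powRr0.
  by rewrite mulrACA nn mulr1.
have := ltW (geometric_ratio_gt0 s0); rewrite -/s => ratio_ge0.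
rewrite ler_wpM2l ?mulr_ge0 ?powR_ge0//; apply: ler_wpM2l => //.
by rewrite -powRrM.
Qed.

End NoiseBounds.

(** * The risk of the block estimator *)

Section BlockShrinkage.
Context {R : realType} (I : finType) (U : {set I}).
Implicit Types (theta z y : I -> R).

Lemma sum_sqrD_le (f g : I -> R) :
  \sum_(k in U) (f k + g k) ^+ 2 <=
    2 * \sum_(k in U) f k ^+ 2 + 2 * \sum_(k in U) g k ^+ 2.
Proof.
rewrite !mulr_sumr -big_split; apply: ler_sum => k _.
by have := sqr_ge0 (f k - g k); rewrite /=; nra.
Qed.

(* Comparing [eps^2 |z|^2] with a quarter of the threshold [t]: below it, the
   block is kept only if [|theta|^2 >= t / 4], so the loss is of the order of
   [min (|theta|^2) t]; above it, the noise dominates everything. *)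
Lemma block_shrinkage_le theta z (eps t : R) (y := fun k => theta k + eps * z k)
    (S := \sum_(k in U) y k ^+ 2) (Z := eps ^+ 2 * \sum_(k in U) z k ^+ 2) :
  0 < t ->
  \sum_(k in U) (y k * Num.max (1 - t / S) 0 - theta k) ^+ 2 <=
    10 * Num.min (\sum_(k in U) theta k ^+ 2) t + 10 * (Z * (t / 4 < Z)%R%:R).
Proof.
move=> t0; set A := \sum_(k in U) theta k ^+ 2.
have A0 : 0 <= A by apply: sumr_ge0 => k _; rewrite sqr_ge0.
have S0 : 0 <= S by apply: sumr_ge0 => k _; rewrite sqr_ge0.
have ZE : Z = \sum_(k in U) (eps * z k) ^+ 2.
  by rewrite /Z mulr_sumr; apply: eq_bigr => k _; rewrite exprMn.
have Z0 : 0 <= Z by rewrite ZE; apply: sumr_ge0 => k _; rewrite sqr_ge0.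
have SAZ : S <= 2 * A + 2 * Z by rewrite ZE; exact: sum_sqrD_le.
have ASZ : A <= 2 * S + 2 * Z.
  have := sum_sqrD_le y (fun k => - (eps * z k)).
  under eq_bigr do rewrite /y addrK.
  by under [X in _ + 2 * X]eq_bigr do rewrite sqrrN; rewrite ZE.
have minE : A <= Num.min A t \/ t <= Num.min A t.
  by case: (leP A t) => h; [left|right].
have min0 : 0 <= Num.min A t by rewrite le_min A0 ltW.
have indE : Z <= t / 4 \/ (t / 4 < Z)%R%:R = 1 :> R.
  by case: (leP Z (t / 4)) => h; [left|right].
have ind0 : 0 <= Z * (t / 4 < Z)%R%:R by rewrite mulr_ge0.
have [St|tS] := leP S t.
  have -> : \sum_(k in U) (y k * Num.max (1 - t / S) 0 - theta k) ^+ 2 = A.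
    apply: eq_bigr => k kU; suff -> : y k * Num.max (1 - t / S) 0 = 0.
      by rewrite sub0r sqrrN.
    (* When [S = 0] the quotient [t / S] is [0] and the shrinkage factor is [1], but [y] vanishes on
       the block. *)
    have [S00|S00] := eqVneq S 0.
      have : y k ^+ 2 <= 0.
        by rewrite -S00 /S (bigD1 k)//= lerDl sumr_ge0// => i _; rewrite sqr_ge0.
      by rewrite le_eqVlt ltNge sqr_ge0 orbF sqrf_eq0 => /eqP ->; rewrite mul0r.
    have Sp : 0 < S by rewrite lt_def S00.
    rewrite (max_idPr _) ?mulr0// subr_le0.
    by rewrite ler_pdivlMr// mul1r.
  by case: minE => h1; case: indE => h2; rewrite ?h2 in ind0 *; lra.
have Sp : 0 < S by exact: lt_trans tS.
have tS1 : t / S <= 1 by rewrite ler_pdivrMr// mul1r ltW.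
have lossle : \sum_(k in U) (y k * Num.max (1 - t / S) 0 - theta k) ^+ 2 <=
    2 * Z + 2 * t.
  rewrite (eq_bigr (fun k => (eps * z k + - (t / S) * y k) ^+ 2)); last first.
    move=> k _; rewrite (max_idPl _) ?subr_ge0//; congr (_ ^+ 2).
    by rewrite /y; ring.
  apply: le_trans (sum_sqrD_le _ _) _; rewrite -ZE lerD2l ler_wpM2l//.
  under eq_bigr do rewrite exprMn.
  rewrite -mulr_sumr -/S sqrrN expr2 -mulrA divfK ?gt_eqF//.
  by rewrite -[leRHS]mul1r ler_wpM2r// ltW.
(* This case fixes the constant [10]. If [Z <= t / 4], then [t < S] forces [t < 4 A], and the loss
   is at most [5 t / 2 < 10 A]; if [t / 4 < Z], it is at most [2 Z + 2 t < 10 Z]. *)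
by case: minE => h1; case: indE => h2; rewrite ?h2 in ind0 *; lra.
Qed.

End BlockShrinkage.

(** * Comparison of power sums on a finite set *)

Section LpNorms.
Context {R : realType} (I : finType) (U : {set I}) (x : I -> R).

Lemma sum_sqr_ge0 : 0 <= \sum_(k in U) x k ^+ 2.
Proof. by apply: sumr_ge0 => k _; rewrite sqr_ge0. Qed.

Lemma sum_powR_ge0 (p : R) : 0 <= \sum_(k in U) `|x k| `^ p.
Proof. by apply: sumr_ge0 => k _; rewrite powR_ge0. Qed.

Lemma sqr_norm_powR (a : R) : a ^+ 2 = `|a| `^ 2.
Proof. by rewrite powR_mulrn// real_normK// num_real. Qed.

(** Each [|x k|] is at most the [p]-norm, which bounds the factor [|x k|^(2 - p)] in
    [|x k|^2 = |x k|^p |x k|^(2 - p)]. *)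
Lemma sum_sqr_le_lp (p : R) : 0 < p -> p <= 2 ->
  \sum_(k in U) x k ^+ 2 <= (\sum_(k in U) `|x k| `^ p) `^ (2 / p).
Proof.
move=> p0 p2; set S := \sum_(k in U) `|x k| `^ p.
have S0 : 0 <= S by exact: sum_powR_ge0.
have xN k : k \in U -> `|x k| <= S `^ p^-1.
  move=> kU; rewrite -[leLHS]powRr1// -(mulfV (_ : p != 0)) ?gt_eqF// powRrM.
  rewrite ge0_ler_powR ?nnegrE ?powR_ge0 ?invr_ge0 ?(ltW p0)//.
  by rewrite /S (bigD1 k)//= lerDl sumr_ge0// => i _; rewrite powR_ge0.
apply: (@le_trans _ _ (\sum_(k in U) `|x k| `^ p * (S `^ p^-1) `^ (2 - p))).
  apply: ler_sum => k kU; rewrite sqr_norm_powR.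
  have -> : 2 = p + (2 - p) :> R by ring.
  have [->|xk0] := eqVneq (x k) 0.
    rewrite normr0 powR0 ?mulr_ge0 ?powR_ge0//.
    by have -> : p + (2 - p) = 2 by ring.
  rewrite powRD_gt0 ?normr_gt0// ler_wpM2l ?powR_ge0//.
  have -> : p + (2 - p) - p = 2 - p by ring.
  by rewrite ge0_ler_powR ?subr_ge0 ?nnegrE ?powR_ge0 ?xN.
rewrite -mulr_suml -/S -powRrM.
have [->|Sn0] := eqVneq S 0; first by rewrite mul0r powR_ge0.
have Sp : 0 < S by rewrite lt_def Sn0.
rewrite -{1}(powRr1 S0) -powRD_gt0// le_eqVlt; apply/orP; left; apply/eqP.
by congr (_ `^ _); field; rewrite gt_eqF.
Qed.

(** Interpolation: the minimum is raised to the powers [1 - p / 2] and [p / 2]; the first factor is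
    bounded through [t], the second through the sum of squares and [sum_sqr_le_lp]. *)
Lemma min_sum_sqr_le (p t : R) : 0 < p -> p <= 2 -> 0 < t ->
  Num.min (\sum_(k in U) x k ^+ 2) t <=
    t `^ (1 - p / 2) * \sum_(k in U) `|x k| `^ p.
Proof.
move=> p0 p2 t0; set A := \sum_(k in U) x k ^+ 2.
have A0 : 0 <= A by exact: sum_sqr_ge0.
have [A00|An0] := eqVneq A 0.
  apply: le_trans (_ : 0 <= _); first by rewrite A00 ge_min lexx.
  by rewrite mulr_ge0 ?powR_ge0 ?sum_powR_ge0.
have Ap : 0 < A by rewrite lt_def An0.
set m := Num.min A t; have mp : 0 < m by rewrite lt_min Ap.
have -> : m = m `^ (1 - p / 2) * m `^ (p / 2) by rewrite -powRD_gt0// subrK powRr1// ltW.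
apply: ler_pM; rewrite ?powR_ge0//.
  by rewrite ge0_ler_powR ?nnegrE ?(ltW mp) ?(ltW t0)//; [lra|rewrite ge_min lexx orbT].
apply: (@le_trans _ _ (A `^ (p / 2))).
  by rewrite ge0_ler_powR ?nnegrE ?(ltW mp)//; [lra|rewrite ge_min lexx].
apply: (@le_trans _ _ (((\sum_(k in U) `|x k| `^ p) `^ (2 / p)) `^ (p / 2))).
  rewrite ge0_ler_powR ?nnegrE ?powR_ge0//; [lra|exact: sum_sqr_le_lp].
rewrite -powRrM (_ : 2 / p * (p / 2) = 1) ?powRr1 ?sum_powR_ge0//.
by field; rewrite gt_eqF.
Qed.

(** The tangent at [1] of a concave power, obtained from the convexity of [expR] between [ln t] and
    [0]. *)
Lemma powR_le_tangent (t a : R) : 0 <= t -> 0 < a <= 1 -> t `^ a <= a * t + (1 - a).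
Proof.
move=> t0 /andP[a0 a1]; have [->|tn0] := eqVneq t 0.
  by rewrite powR0 ?gt_eqF// mulr0 add0r subr_ge0.
have tp : 0 < t by rewrite lt_def tn0.
have := convex_expR (Itv01 (ltW a0) a1) (ln t) 0.
by rewrite !convRE/= mulr0 addr0 expR0 mulr1 lnK// powR_expR// /unstable.onem.
Qed.

(** The tangent bound is applied to [|x k|^p / m], where [m] is the mean of the [|x k|^p]; with this
    normalization the affine terms add up to the cardinality. *)
Lemma sum_sqr_le_card_lp (p : R) : 2 <= p ->
  \sum_(k in U) x k ^+ 2 <=
    #|U|%:R `^ (1 - 2 / p) * (\sum_(k in U) `|x k| `^ p) `^ (2 / p).
Proof.
move=> p2; have p0 : 0 < p by lra.
set S := \sum_(k in U) `|x k| `^ p.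
have S0 : 0 <= S by exact: sum_powR_ge0.
have [S00|Sn0] := eqVneq S 0.
  rewrite big1 ?mulr_ge0 ?powR_ge0// => k kU; apply/eqP; rewrite sqrf_eq0 -normr_eq0.
  have /eqP : `|x k| `^ p == 0.
    rewrite eq_le powR_ge0 andbT -[leRHS]S00 /S (bigD1 k)//= lerDl.
    by apply: sumr_ge0 => i _; exact: powR_ge0.
  by move/powR_eq0_eq0 => ->.
have Sp : 0 < S by rewrite lt_def Sn0.
have [N0|N0] := posnP #|U|.
  by move/eqP: Sn0; rewrite /S (cards0_eq N0) big_set0.
have Np : 0 < #|U|%:R :> R by rewrite ltr0n.
set N : R := #|U|%:R in Np *; pose m := S / N.
have mp : 0 < m by rewrite divr_gt0.
have a01 : 0 < 2 / p <= 1 by rewrite divr_gt0//= ler_pdivrMr// mul1r.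
apply: (@le_trans _ _ (\sum_(k in U) m `^ (2 / p) * (2 / p * (`|x k| `^ p / m) + (1 - 2 / p)))).
  apply: ler_sum => k kU; rewrite sqr_norm_powR.
  have -> : `|x k| `^ 2 = m `^ (2 / p) * (`|x k| `^ p / m) `^ (2 / p).
    rewrite -powRM ?divr_ge0 ?powR_ge0 ?(ltW mp)// mulrC divfK ?gt_eqF// -powRrM.
    by congr (_ `^ _); field; rewrite gt_eqF.
  by rewrite ler_wpM2l ?powR_ge0// powR_le_tangent// divr_ge0 ?powR_ge0 ?(ltW mp).
rewrite -mulr_sumr big_split/= -mulr_sumr -mulr_suml -/S sumr_const -[_ *+ #|_|]mulr_natl -/N.
have -> : S / m = N by rewrite /m; field; rewrite !gt_eqF.
have -> : 2 / p * N + N * (1 - 2 / p) = N by ring.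
rewrite /m powRM ?invr_ge0 ?(ltW Np)// mulrAC -mulrA mulrC.
rewrite ler_wpM2r ?powR_ge0// -powR_inv1 ?(ltW Np)// -powRrM -{1}(powRr1 (ltW Np)).
rewrite -powRD_gt0// le_eqVlt; apply/orP; left; apply/eqP; congr (_ `^ _); ring.
Qed.

End LpNorms.

(** * Level-wise consequences of the smoothness bound *)

Section Smoothness.
Context {R : realType} {d : nat}.
Variables (mu : 'I_d -> R) (c upsilon s : R) (p q : \bar R) (M : R).
Hypotheses (c_ge1 : 1 <= c) (p_gt0 : (0 < p)%E) (q_gt0 : (0 < q)%E) (M_gt0 : 0 < M).
Variable theta : level_family mu c upsilon R.
Hypothesis theta_in : Theta mu c upsilon s p q M theta.

Lemma lp_norm_ge0 (I : finType) (x : I -> R) : 0 <= lp_norm p x.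
Proof.
rewrite /lp_norm; case: (p) => [p'| |]; first exact: powR_ge0.
  by elim/big_ind: _ => // a b a0 b0; rewrite le_max a0.
by elim/big_ind: _ => // a b a0 b0; rewrite le_max a0.
Qed.

Lemma level_norm_ge0 j (l : B c upsilon j) : 0 <= level_norm s p theta l.
Proof. by rewrite /level_norm mulr_ge0 ?powR_ge0 ?lp_norm_ge0. Qed.

Lemma sum_level_norm_powR_le (q' : R) j : q = q'%:E -> 0 < q' ->
  \sum_(l : B c upsilon j) level_norm s p theta l `^ q' <= M `^ q'.
Proof.
move=> qE q'0; have := theta_in; rewrite /Theta/= /smoothness_norm qE.
set S := (\sum_(0 <= i <oo) _)%E => SM.
have F0 i : (0 <= \sum_(l : B c upsilon i) (level_norm s p theta l `^ q')%:E)%E.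
  by apply: sume_ge0 => l _; rewrite lee_fin powR_ge0.
have S0 : (0 <= S)%E by apply: nneseries_ge0 => i _ _.
have SMq : (S <= (M `^ q')%:E)%E.
  have -> : S = ((S `^ q'^-1) `^ q')%E.
    by rewrite -poweRrM ?mulVf ?poweRe1 ?gt_eqF.
  rewrite -poweR_EFin; apply: gt0_ler_poweR => //; first exact: ltW.
    by rewrite in_itv/= leey poweR_ge0.
  by rewrite in_itv/= leey lee_fin ltW.
rewrite -lee_fin -sumEFin; apply: le_trans SMq.
apply: le_trans (nneseries_lim_ge j.+1 (fun i _ _ => F0 i)) => /=.
rewrite big_nat_recr//=; apply: leeDr; apply: sume_ge0 => i _; exact: F0.
Qed.

Lemma level_norm_le j (l : B c upsilon j) : level_norm s p theta l <= M.
Proof.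
case qE : q q_gt0 => [q'| |//].
  rewrite lte_fin => q'0.
  rewrite -[leLHS]powRr1 ?level_norm_ge0// -(mulfV (_ : q' != 0)) ?gt_eqF// powRrM.
  rewrite -[leRHS]powRr1 ?(ltW M_gt0)// -(mulfV (_ : q' != 0)) ?gt_eqF// [leRHS]powRrM.
  rewrite ge0_ler_powR ?nnegrE ?powR_ge0 ?invr_ge0 ?(ltW q'0)//.
  apply: le_trans (sum_level_norm_powR_le j qE q'0).
  by rewrite (bigD1 l)//= lerDl sumr_ge0// => i _; rewrite powR_ge0.
move=> _; have := theta_in; rewrite /Theta/= /smoothness_norm qE => SM.
rewrite -lee_fin; apply: le_trans SM; apply: ereal_sup_ubound.
by exists j, l.
Qed.

(** If [q <= t], the bound [M] on each level norm reduces the exponent [t] to [q]. If [upsilon = 0],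
    a level has at most [c] indices [l] and the bound [M] suffices: this is how the restriction on
    [q] is lifted. *)
Lemma sum_level_norm_le (t : R) j : 0 < t -> (q <= t%:E)%E \/ upsilon = 0 ->
  \sum_(l : B c upsilon j) level_norm s p theta l `^ t <= c * M `^ t.
Proof.
move=> t0 [qt|ups0].
  case qE : q q_gt0 qt => [q'| |//]; rewrite ?lte_fin ?lee_fin => q'0 // qt.
  apply: (@le_trans _ _ (\sum_(l : B c upsilon j) M `^ (t - q') * level_norm s p theta l `^ q')).
    apply: ler_sum => l _; have [->|ln0] := eqVneq (level_norm s p theta l) 0.
      by rewrite powR0 ?gt_eqF// mulr_ge0 ?powR_ge0.
    have lp : 0 < level_norm s p theta l by rewrite lt_def ln0 level_norm_ge0.
    have -> : level_norm s p theta l `^ t =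
        level_norm s p theta l `^ (t - q') * level_norm s p theta l `^ q'.
      by rewrite -powRD_gt0// subrK.
    rewrite ler_wpM2r ?powR_ge0//.
    by apply: ge0_ler_powR; rewrite ?nnegrE ?subr_ge0//;
      [exact: level_norm_ge0|exact: ltW|exact: level_norm_le].
  rewrite -mulr_sumr; apply: (@le_trans _ _ (M `^ (t - q') * M `^ q')).
    by rewrite ler_wpM2l ?powR_ge0//; exact: sum_level_norm_powR_le.
  by rewrite -powRD_gt0// subrK ler_peMl ?powR_ge0.
apply: (@le_trans _ _ (\sum_(l : B c upsilon j) M `^ t)).
  apply: ler_sum => l _.
  by apply: ge0_ler_powR; rewrite ?nnegrE ?(ltW t0)//;
    [exact: level_norm_ge0|exact: ltW|exact: level_norm_le].
rewrite sumr_const -[leLHS]mulr_natl ler_wpM2r ?powR_ge0//.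
apply: le_trans (card_B_le _ _ (le_trans ler01 c_ge1)) _.
by rewrite ups0 mul0r powRr0 mulr1.
Qed.

(** Passing from exponent [p] to [2] costs [2^(j dstar (1 - 2 / p))], exactly what the term
    [dstar / 2 - dstar / p] of the weight compensates once squared. *)
Lemma sum_theta_sqr_p_ge2 j (l : B c upsilon j) : (2%:E <= p)%E ->
  \sum_(k : D mu j) theta l k ^+ 2 <=
    2 `^ (- (j%:R * (2 * s))) * level_norm s p theta l `^ 2.
Proof.
move=> p2; rewrite /level_norm powRM ?powR_ge0 ?lp_norm_ge0// -powRrM mulrA -powRD_gt0//.
have sumT (F : D mu j -> R) : \sum_k F k = \sum_(k in [set: D mu j]%SET) F k.
  by symmetry; apply: eq_bigl => k; exact: finset.in_setT.
case pE : p p2 => [p'| |//] p2.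
  have p'2 : 2 <= p' by rewrite -lee_fin.
  have p'0 : 0 < p' by lra.
  rewrite sumT; apply: le_trans (sum_sqr_le_card_lp _ _ p'2) _.
  rewrite /lp_norm /dstar_over_p -sumT -powRrM [p'^-1 * 2]mulrC ler_wpM2r ?powR_ge0//.
  apply: (@le_trans _ _ ((2 `^ (dstar mu * j%:R)) `^ (1 - 2 / p'))).
    rewrite ge0_ler_powR ?nnegrE ?powR_ge0 ?cardsT ?card_D_le//.
    by rewrite subr_ge0 ler_pdivrMr// mul1r.
  rewrite -powRrM le_eqVlt; apply/orP; left; apply/eqP; congr (_ `^ _).
  by field; rewrite gt_eqF.
rewrite /dstar_over_p/= subr0.
set m := \big[Num.max/0]_i `|theta l i|.
have xm k : theta l k ^+ 2 <= m `^ 2.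
  rewrite sqr_norm_powR ge0_ler_powR ?nnegrE//; last first.
    exact: (@le_bigmax _ _ _ 0 (fun i => `|theta l i|) k).
  exact: le_trans (normr_ge0 _) (@le_bigmax _ _ _ 0 (fun i => `|theta l i|) k).
apply: (@le_trans _ _ (\sum_(k : D mu j) m `^ 2)); first exact: ler_sum.
rewrite sumr_const -[leLHS]mulr_natl ler_wpM2r ?powR_ge0//.
apply: le_trans (card_D_le mu j) _.
by rewrite le_eqVlt; apply/orP; left; apply/eqP; congr (_ `^ _); field.
Qed.

Section SmallP.
Variable p' : R.
Hypotheses (pE : p = p'%:E) (p'_gt0 : 0 < p') (p'_le2 : p' <= 2).

Lemma sum_theta_powR j (l : B c upsilon j) :
  \sum_(k : D mu j) `|theta l k| `^ p' =
    2 `^ (- (j%:R * (p' * (s + dstar mu / 2) - dstar mu))) * level_norm s p theta l `^ p'.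
Proof.
rewrite /level_norm powRM ?powR_ge0 ?lp_norm_ge0// -powRrM mulrA -powRD_gt0//.
rewrite /lp_norm pE /dstar_over_p -powRrM mulVf ?gt_eqF// powRr1; last first.
  by apply: sumr_ge0 => k _; rewrite powR_ge0.
rewrite [X in 2 `^ X](_ : _ = 0) ?powRr0 ?mul1r//.
by field; rewrite gt_eqF.
Qed.

Lemma sum_theta_sqr_p_le2 j (l : B c upsilon j) :
  \sum_(k : D mu j) theta l k ^+ 2 <=
    2 `^ (- (j%:R * (2 * (s + dstar mu / 2 - dstar mu / p')))) * level_norm s p theta l `^ 2.
Proof.
have sumT (F : D mu j -> R) : \sum_k F k = \sum_(k in [set: D mu j]%SET) F k.
  by symmetry; apply: eq_bigl => k; exact: finset.in_setT.
rewrite sumT; apply: le_trans (sum_sqr_le_lp _ _ p'_gt0 p'_le2) _.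
rewrite -sumT sum_theta_powR powRM ?powR_ge0// -!powRrM.
rewrite [p' * (2 / p')]mulrC divfK ?gt_eqF// ler_wpM2r ?powR_ge0//.
rewrite le_eqVlt; apply/orP; left; apply/eqP; congr (_ `^ _).
by field; rewrite gt_eqF.
Qed.

End SmallP.

End Smoothness.

(** * Loss of a level, and an oracle inequality for the risk *)

Section RiskBounds.
Context {R : realType} {d : nat}.
Variables (mu : 'I_d -> R) (c upsilon r delta lambda : R) (n : nat).
Hypotheses (d_gt0 : (0 < d)%N) (r_gt0 : 0 < r) (c_ge0 : 0 <= c) (lambda_gt0 : 0 < lambda).
Hypotheses (n_gt0 : (0 < n)%N) (L_gt0 : (0 < L d r n)%N).
Context {disp : measure_display} {T : measurableType disp}
  {P : probability T R}.
Variable z : level_family mu c upsilon {RV P >-> R}.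
Variable theta : level_family mu c upsilon R.

Let est w := estimator r delta lambda n (observation r n (fun j l k => z l k w) theta).

Let loss (j : nat) (l : B c upsilon j) (k : D mu j) :=
  ('E_P[fun w => ((est w l k - theta l k) ^+ 2)%R])%E.

Let term (j : nat) := (\sum_(l : B c upsilon j) block_sum upsilon r delta n (loss l))%E.

(** The factor [L^d] appears because this is compared with the sum of squares of a block, whereas
    the estimator uses the mean. *)
Let threshold (j : nat) : R := lambda * n%:R `^ (- r) * 2 `^ (delta * j%:R) * (L d r n)%:R ^+ d.

Let exceed (j : nat) (l : B c upsilon j) (K : A mu r n j) : set T :=
  [set w' | lambda * 2 `^ (delta * j%:R) * (L d r n)%:R ^+ d / 4
            < \sum_(k' in U K) z l k' w' ^+ 2].

Let noise (j : nat) := (\sum_(l : B c upsilon j) \sum_(K : A mu r n j) \sum_(k in U K)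
  'E_P[fun w => (z l k w ^+ 2 * \1_(exceed l K) w)%R])%E.

(** The deterministic part of the bound on a level. Levels below [j0] also receive a value: it only
    enlarges the bound, and sums over levels can then be cut at a scale chosen without reference to
    [j0]. *)
Definition oracle_loss (j : nat) : R := if (j <= Jstar mu upsilon r delta n)%N
  then 10 * \sum_(l : B c upsilon j) \sum_(K : A mu r n j)
         Num.min (\sum_(k in U K) theta l k ^+ 2) (threshold j)
  else \sum_(l : B c upsilon j) \sum_(k : D mu j) theta l k ^+ 2.

Let nR_gt0 : 0 < n%:R :> R. Proof. by rewrite ltr0n. Qed.

Let noise_level : (n%:R `^ (- r / 2)) ^+ 2 = n%:R `^ (- r) :> R.
Proof.
by rewrite -powR_mulrn ?powR_ge0// -powRrM divfK.
Qed.

Let noise_ge0 j : (0 <= noise j)%E.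
Proof.
apply: sume_ge0 => l _; apply: sume_ge0 => K _; apply: sume_ge0 => k _.
apply: expectation_ge0 => w; rewrite mulr_ge0 ?sqr_ge0//.
Qed.

Let loss_ge0 j (l : B c upsilon j) (k : D mu j) : (0 <= loss l k)%E.
Proof. by apply: expectation_ge0 => w; exact: sqr_ge0. Qed.

Let term_ge0 j : (0 <= term j)%E.
Proof.
apply: sume_ge0 => l _; rewrite /block_sum; case: ifP => _.
  by apply: sume_ge0 => K _; apply: sume_ge0 => k _.
by apply: sume_ge0 => k _.
Qed.

Let threshold_gt0 j : 0 < threshold j.
Proof. by rewrite !mulr_gt0 ?powR_gt0// exprn_gt0// ltr0n. Qed.

Let oracle_loss_ge0 j : 0 <= oracle_loss j.
Proof.
rewrite /oracle_loss; case: ifP => _; last first.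
  by apply: sumr_ge0 => l _; apply: sumr_ge0 => k _; rewrite sqr_ge0.
rewrite mulr_ge0//; apply: sumr_ge0 => l _; apply: sumr_ge0 => K _.
by rewrite le_min sum_sqr_ge0 ltW.
Qed.

Lemma low_term_le (Q : R) j : (j < j0 mu r n)%N ->
  (forall (l : B c upsilon j) (k : D mu j),
     ('E_P[fun w => (z l k w ^+ 2)%R] <= (Q * 2 `^ (delta * j%:R))%:E)%E) -> 0 <= Q ->
  (term j <= (c * Q * n%:R `^ (- r) * 2 `^ (j%:R * (dstar mu + delta + upsilon)))%:E)%E.
Proof.
move=> jj0 zQ Q0; set b := Q * 2 `^ (delta * j%:R) in zQ *.
have b0 : 0 <= n%:R `^ (- r) * b by rewrite !mulr_ge0 ?powR_ge0.
have lossle (l : B c upsilon j) (k : D mu j) : (loss l k <= (n%:R `^ (- r) * b)%:E)%E.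
  apply: (@le_trans _ _ ((n%:R `^ (- r))%:E * 'E_P[fun w => (z l k w ^+ 2)%R])%E); last first.
    by rewrite EFinM lee_wpmul2l ?lee_fin ?powR_ge0// zQ.
  rewrite /loss !expectation_integral -ge0_integralZl ?lee_fin ?powR_ge0//; last 2 first.
  - by apply/measurable_EFinP; exact: measurable_funX.
  - by move=> w _; rewrite lee_fin sqr_ge0.
  rewrite le_eqVlt; apply/orP; left; apply/eqP; apply: eq_integral => w _.
  rewrite -EFinM; congr (_%:E); rewrite /est /estimator jj0 /observation.
  by rewrite addrAC subrr add0r exprMn noise_level.
have -> : term j = (\sum_(l : B c upsilon j) \sum_(k : D mu j) loss l k)%E.
  by apply: eq_bigr => l _; rewrite /block_sum leqNgt jj0.
apply: le_trans (sume_le_card (fun l _ => sume_le_card (fun k _ => lossle l k))) _.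
rewrite lee_fin.
apply: (@le_trans _ _ (c * 2 `^ (upsilon * j%:R) * (2 `^ (dstar mu * j%:R) * (n%:R `^ (- r) * b)))).
  apply: ler_pM; rewrite ?mulr_ge0//; first exact: card_B_le.
  by rewrite ler_wpM2r// card_D_le.
rewrite /b le_eqVlt; apply/orP; left; apply/eqP.
have -> : 2 `^ (j%:R * (dstar mu + delta + upsilon)) =
    2 `^ (upsilon * j%:R) * 2 `^ (dstar mu * j%:R) * 2 `^ (delta * j%:R) :> R.
  by rewrite -!powRD_gt0//; congr (_ `^ _); ring.
ring.
Qed.

Lemma high_term_eq j : (j0 mu r n <= j)%N -> (Jstar mu upsilon r delta n < j)%N ->
  term j = (\sum_(l : B c upsilon j) \sum_(k : D mu j) theta l k ^+ 2)%:E.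
Proof.
move=> j0j Jj; rewrite -sumEFin; apply: eq_bigr => l _.
rewrite /block_sum [(j <= _)%N]leqNgt Jj andbF -sumEFin; apply: eq_bigr => k _.
rewrite /loss /est /estimator ltnNge j0j/= leqNgt Jj/=.
by rewrite -(expectation_cst P); congr expectation; apply/funext => w; rewrite sub0r sqrrN.
Qed.

Lemma mid_block_le j (l : B c upsilon j) (K : A mu r n j) :
  (j0 mu r n <= j <= Jstar mu upsilon r delta n)%N ->
  (\sum_(k in U K) loss l k <=
    (10 * Num.min (\sum_(k in U K) theta l k ^+ 2) (threshold j))%:E +
    (10 * n%:R `^ (- r))%:E *
      \sum_(k in U K) 'E_P[fun w => (z l k w ^+ 2 * \1_(exceed l K) w)%R])%E.
Proof.
move=> /andP[j0j jJ]; set t := threshold j; set e : R := n%:R `^ (- r / 2).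
pose y w k := theta l k + e * z l k w.
pose S w := \sum_(k in U K) y w k ^+ 2.
pose Z w := e ^+ 2 * \sum_(k in U K) z l k w ^+ 2.
have Ld : (L d r n)%:R ^+ d != 0 :> R by rewrite expf_neq0// pnatr_eq0 -lt0n.
(* Blocks are disjoint, so the one picked by the estimator is [K]. *)
have estE w k : k \in U K -> est w l k = y w k * Num.max (1 - t / S w) 0.
  move=> kK; rewrite /est /estimator ltnNge j0j/= jJ.
  case: pickP => [K' kK'|/(_ K)]; last by rewrite kK.
  rewrite -(U_disjoint kK kK') {K' kK'}; congr (_ * Num.max (1 - _) 0).
  by rewrite /t /threshold invfM invrK mulrA.
have mz k : measurable_fun setT (fun w => z l k w) by [].
have sumU (F : D mu j -> R) : \sum_(k in U K) F k = \sum_(i <- enum (U K)) F i.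
  by rewrite big_enum.
have my k : measurable_fun setT (y ^~ k).
  by apply: measurable_funD => //; exact: measurable_funM.
have mS : measurable_fun setT S.
  rewrite (_ : S = fun w => \sum_(i <- enum (U K)) y w i ^+ 2); last first.
    by apply/funext => w; rewrite /S sumU.
  by apply: measurable_sum => k; exact: measurable_funX.
have mz2 : measurable_fun setT (fun w => \sum_(k in U K) z l k w ^+ 2).
  rewrite (_ : (fun _ => _) = fun w => \sum_(i <- enum (U K)) z l i w ^+ 2); last first.
    by apply/funext => w; rewrite sumU.
  by apply: measurable_sum => k; exact: measurable_funX.
(* The inverse of [S] is measurable as a real power: [powR] with exponent [-1] agrees with the
   inverse on nonnegative reals, [0] included. *)
have mshrink : measurable_fun setT (fun w => Num.max (1 - t / S w) 0).
  rewrite (_ : (fun _ => _) = fun w => Num.max (1 - t * S w `^ (-1)) 0); last first.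
    by apply/funext => w; rewrite powR_inv1// sum_sqr_ge0.
  apply: measurable_maxr => //; apply: measurable_funB => //.
  apply: measurable_funM => //.
  exact: (measurableT_comp (measurable_powR (-1)) mS).
have mexc : measurable_fun setT (\1_(exceed l K) : T -> R).
  apply: measurable_indic; rewrite -[X in measurable X]setTI.
  have -> : exceed l K = (fun w => \sum_(k in U K) z l k w ^+ 2) @^-1`
      `](lambda * 2 `^ (delta * j%:R) * (L d r n)%:R ^+ d / 4), +oo[%classic.
    by apply/seteqP; split => w /=; rewrite in_itv/= andbT.
  exact: mz2.
pose F k w := (y w k * Num.max (1 - t / S w) 0 - theta l k) ^+ 2.
have mF k : measurable_fun setT (fun w => (F k w)%:E).
  apply/measurable_EFinP; apply: measurable_funX; apply: measurable_funB => //.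
  exact: measurable_funM.
pose m : R := Num.min (\sum_(k in U K) theta l k ^+ 2) t.
have t_gt0 : 0 < t by exact: threshold_gt0.
have m0 : 0 <= m by rewrite /m le_min sum_sqr_ge0 (ltW t_gt0).
pose H w := \sum_(k in U K) (z l k w ^+ 2 * \1_(exceed l K) w).
have HE w : H w = (\sum_(k in U K) z l k w ^+ 2) * \1_(exceed l K) w.
  by rewrite /H mulr_suml.
have H0 w : 0 <= H w by rewrite HE mulr_ge0// sum_sqr_ge0.
have mH : measurable_fun setT H.
  rewrite (_ : H = fun w => (\sum_(k in U K) z l k w ^+ 2) * \1_(exceed l K) w).
    exact: measurable_funM.
  by apply/funext => w; exact: HE.
have e2 : e ^+ 2 = n%:R `^ (- r) by exact: noise_level.
have FH w : \sum_(k in U K) F k w <= 10 * m + 10 * n%:R `^ (- r) * H w.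
  apply: le_trans (block_shrinkage_le _ _ _ _ (threshold_gt0 j)) _.
  have indle : (t / 4 < e ^+ 2 * \sum_(k in U K) z l k w ^+ 2)%R%:R <= \1_(exceed l K) w :> R.
    case: (boolP (_ < _)) => // tZ; rewrite indicE mem_set//= /exceed/=.
    rewrite -(ltr_pM2l (powR_gt0 (- r) nR_gt0)) -e2; apply: le_lt_trans tZ.
    by rewrite le_eqVlt; apply/orP; left; apply/eqP; rewrite e2 /t /threshold; ring.
  rewrite lerD2l -[leRHS]mulrA ler_wpM2l// HE -e2 [leRHS]mulrA.
  by apply: ler_wpM2l => //; rewrite mulr_ge0 ?sqr_ge0 ?sum_sqr_ge0.
have sumE (f : D mu j -> T -> R) : (forall k w, 0 <= f k w) ->
    (forall k, measurable_fun setT (fun w => (f k w)%:E)) ->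
    (\sum_(k in U K) 'E_P[f k] = \int[P]_w (\sum_(k in U K) f k w)%:E)%E.
  move=> f0 mf; under eq_bigr do rewrite expectation_integral.
  rewrite -big_enum/= -ge0_integral_sum//; last by move=> k w _; rewrite lee_fin.
  by apply: eq_integral => w _; rewrite sumEFin sumU.
have -> : (\sum_(k in U K) loss l k = \sum_(k in U K) 'E_P[F k])%E.
  apply: eq_bigr => k kK; rewrite /loss; congr expectation; apply/funext => w.
  by rewrite estE.
rewrite sumE//; last by move=> k w; exact: sqr_ge0.
rewrite sumE; last 2 first.
- by move=> k w; rewrite mulr_ge0 ?sqr_ge0.
- move=> k; apply/measurable_EFinP; apply: measurable_funM => //.
  exact: measurable_funX.
have c0 : 0 <= 10 * n%:R `^ (- r) :> R by rewrite mulr_ge0 ?powR_ge0.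
have mHE : measurable_fun setT (fun w => (H w)%:E) by exact/measurable_EFinP.
have H0E w : [set: T] w -> (0 <= (H w)%:E)%E by rewrite lee_fin.
rewrite -(ge0_integralZl P measurableT mHE H0E (_ : 0 <= (10 * n%:R `^ (- r))%:E)%E) ?lee_fin//.
have -> : ((10 * m)%:E = \int[P]_w (10 * m)%:E)%E.
  by rewrite integral_cst//= probability_setT mule1.
have p1 w : [set: T] w -> (0 <= (10 * m)%:E)%E by rewrite lee_fin mulr_ge0.
have p2 w : [set: T] w -> (0 <= (10 * n%:R `^ (- r))%:E * (H w)%:E)%E.
  by move=> _; rewrite -EFinM lee_fin mulr_ge0.
have m2 : measurable_fun setT (fun w => ((10 * n%:R `^ (- r))%:E * (H w)%:E)%E).
  exact: emeasurable_funM.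
have m1 : measurable_fun setT (fun w : T => (10 * m)%:E) by exact: measurable_cst.
rewrite -(ge0_integralD P measurableT p1 m1 p2 m2).
apply: ge0_le_integral => //.
- by move=> w _; rewrite lee_fin sumr_ge0// => k _; exact: sqr_ge0.
- rewrite (_ : (fun _ => _) = fun w => (\sum_(i <- enum (U K)) (F i w)%:E)%E); last first.
    by apply/funext => w; rewrite sumEFin sumU.
  exact: emeasurable_sum.
- exact: emeasurable_funD.
- by move=> w _; rewrite -EFinM -EFinD lee_fin.
Qed.

Lemma mid_term_le j : (j0 mu r n <= j <= Jstar mu upsilon r delta n)%N ->
  (term j <= (oracle_loss j)%:E + (10 * n%:R `^ (- r))%:E * noise j)%E.
Proof.
move=> jJ; have /andP[_ jJ'] := jJ.
have c0 : 0 <= 10 * n%:R `^ (- r) :> R by rewrite mulr_ge0 ?powR_ge0.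
have nn0 (l : B c upsilon j) (K : A mu r n j) : (0 <= \sum_(k in U K)
    'E_P[fun w => (z l k w ^+ 2 * \1_(exceed l K) w)%R])%E.
  by apply: sume_ge0 => k _; apply: expectation_ge0 => w; rewrite mulr_ge0 ?sqr_ge0.
apply: (@le_trans _ _ (\sum_(l : B c upsilon j) \sum_(K : A mu r n j)
    ((10 * Num.min (\sum_(k in U K) theta l k ^+ 2) (threshold j))%:E +
    (10 * n%:R `^ (- r))%:E *
      \sum_(k in U K) 'E_P[fun w => (z l k w ^+ 2 * \1_(exceed l K) w)%R]))%E).
  apply: lee_sum => l _; rewrite /block_sum jJ; apply: lee_sum => K _.
  exact: mid_block_le.
rewrite /oracle_loss jJ' /noise.
under eq_bigr do rewrite big_split/=.
rewrite big_split/=; apply: leeD.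
  under eq_bigr do rewrite sumEFin -mulr_sumr.
  by rewrite sumEFin -mulr_sumr.
rewrite ge0_sume_distrr; last by move=> l _; apply: sume_ge0.
apply: lee_sum => l _.
by rewrite ge0_sume_distrr.
Qed.

Let sigma := dstar mu + delta + upsilon.

Lemma partial_risk_le (Q Q2 : R) (N : nat) : 0 <= Q -> 0 < sigma ->
  (forall j, (j < j0 mu r n)%N -> forall (l : B c upsilon j) (k : D mu j),
     ('E_P[fun w => (z l k w ^+ 2)%R] <= (Q * 2 `^ (delta * j%:R))%:E)%E) ->
  A2 r delta n z lambda Q2 ->
  (\sum_(0 <= j < N) term j <=
    (c * Q * n%:R `^ (- r) * ((1 - 2 `^ (- sigma))^-1 * 2 `^ ((j0 mu r n)%:R * sigma)) +
     10 * n%:R `^ (- r) * Q2 + \sum_(j < N) oracle_loss j)%:E)%E.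
Proof.
move=> Q0 s0 zQ zA2.
set c1 := c * Q * n%:R `^ (- r); set c2 : R := 10 * n%:R `^ (- r).
have c1_ge0 : 0 <= c1 by rewrite !mulr_ge0 ?powR_ge0.
have c2_ge0 : 0 <= c2 by rewrite mulr_ge0 ?powR_ge0.
pose P1 j := (j < j0 mu r n)%N.
pose P2 j := (j0 mu r n <= j < (Jstar mu upsilon r delta n).+1)%N.
pose low j : R := if P1 j then c1 * 2 `^ (j%:R * sigma) else 0.
pose mid j : \bar R := (if P2 j then c2%:E * noise j else 0)%E.
have mid0 j : (0 <= mid j)%E.
  by rewrite /mid; case: ifP => _ //; rewrite mule_ge0// lee_fin.
have low0 j : 0 <= low j.
  by rewrite /low; case: ifP => _ //; rewrite mulr_ge0// powR_ge0.
have termle j : (term j <= (low j)%:E + mid j + (oracle_loss j)%:E)%E.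
  rewrite /low /mid /P1 /P2 ltnS; have [jj0|j0j] := ltnP j (j0 mu r n).
    rewrite /= adde0; apply: le_trans (low_term_le jj0 (zQ _ jj0) Q0) _.
    by rewrite -EFinD lee_fin lerDl.
  rewrite /= add0e; have [jJ|Jj] := leqP j (Jstar mu upsilon r delta n).
    by rewrite addeC mid_term_le// j0j jJ.
  by rewrite add0e high_term_eq// lee_fin /oracle_loss leqNgt Jj.
apply: (@le_trans _ _ (\sum_(0 <= j < N) ((low j)%:E + mid j + (oracle_loss j)%:E))%E).
  by apply: lee_sum => j _; exact: termle.
rewrite big_split big_split/= EFinD EFinD; apply: leeD; last first.
  by rewrite sumEFin big_mkord.
apply: leeD.
  rewrite sumEFin lee_fin big_mkord /low -big_mkcond/= -mulr_sumr ler_wpM2l//.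
  rewrite powRrM; apply: le_trans (geometric_sum_le s0 (powR_gt0 _ (@ltr0n R 2)) N).
  rewrite big_mkcond [leRHS]big_mkcond; apply: ler_sum => j _; rewrite /P1.
  case: ifP => [jj0|_]; last by case: ifP => _ //; rewrite powR_ge0.
  by rewrite ler_powR ?ler1n// ler_nat ltnW.
(* The partial sum may stop before or after [Jstar]; widening it to the larger index recovers the
   whole sum in (A2), all terms being nonnegative. *)
set N' := (Jstar mu upsilon r delta n).+1.
apply: (@le_trans _ _ (\sum_(0 <= j < maxn N N') mid j)%E).
  by apply: lee_sum_nneg_natr; [move=> j _ _|exact: leq_maxl].
have -> : (\sum_(0 <= j < maxn N N') mid j = \sum_(j0 mu r n <= j < N') c2%:E * noise j)%E.
  transitivity (\sum_(0 <= j < maxn N N' | P2 j) (c2%:E * noise j))%E.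
    by rewrite /mid -big_mkcond.
  rewrite [RHS](big_nat_widenl _ 0)// [RHS](big_nat_widen _ _ _ _ _ (leq_maxr N N')).
  by apply: eq_bigl => j.
rewrite -ge0_sume_distrr; last by move=> j _; exact: noise_ge0.
by rewrite [leRHS]EFinM; apply: lee_wpmul2l; rewrite ?lee_fin.
Qed.

Lemma risk_le (Q Q2 b : R) : 0 <= Q -> 0 < sigma ->
  (forall j, (j < j0 mu r n)%N -> forall (l : B c upsilon j) (k : D mu j),
     ('E_P[fun w => (z l k w ^+ 2)%R] <= (Q * 2 `^ (delta * j%:R))%:E)%E) ->
  A2 r delta n z lambda Q2 ->
  (forall N, \sum_(j < N) oracle_loss j <= b) ->
  (risk r delta lambda n z theta <=
    (c * Q * n%:R `^ (- r) * ((1 - 2 `^ (- sigma))^-1 * 2 `^ ((j0 mu r n)%:R * sigma)) +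
     10 * n%:R `^ (- r) * Q2 + b)%:E)%E.
Proof.
move=> Q0 s0 zQ zA2 oracleb.
apply: lime_le; first by apply: is_cvg_nneseries => j _ _; exact: term_ge0.
apply: nearW => N; apply: le_trans (partial_risk_le N Q0 s0 zQ zA2) _.
by rewrite lee_fin lerD2l.
Qed.

(** By disjointness each [k] is counted at most once; indices outside every block account for the
    inequality. *)
Lemma sum_blocks_le j (f : D mu j -> R) : (forall k, 0 <= f k) ->
  \sum_(K : A mu r n j) \sum_(k in U K) f k <= \sum_k f k.
Proof.
move=> f0; rewrite (exchange_big_dep xpredT)//=; apply: ler_sum => k _.
case: (pickP (fun K : A mu r n j => k \in U K)) => [K kK|noK]; last first.
  by rewrite big_pred0.
rewrite (big_pred1 K)// => K'; apply/idP/eqP => [kK'|-> //].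
exact: U_disjoint kK' kK.
Qed.

Lemma ler_sum_card (I : finType) (F : I -> R) (b : R) :
  (forall i, F i <= b) -> \sum_i F i <= #|I|%:R * b.
Proof.
move=> Fb; apply: (@le_trans _ _ (\sum_(i : I) b)); first exact: ler_sum.
by rewrite sumr_const mulr_natl.
Qed.

(** The number of blocks carries [L^(-d)] and the threshold [L^d]: they cancel, and no logarithm is
    left. *)
Lemma oracle_loss_le_threshold j : (j <= Jstar mu upsilon r delta n)%N ->
  oracle_loss j <= 10 * c * lambda * n%:R `^ (- r) * 2 `^ (j%:R * sigma).
Proof.
move=> jJ; rewrite /oracle_loss jJ -!mulrA ler_wpM2l//.
have Ld : 0 < (L d r n)%:R ^+ d :> R by rewrite exprn_gt0// ltr0n.
have t0 := ltW (threshold_gt0 j).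
have hA (l : B c upsilon j) : \sum_(K : A mu r n j)
    Num.min (\sum_(k in U K) theta l k ^+ 2) (threshold j) <=
    2 `^ (dstar mu * j%:R) / (L d r n)%:R ^+ d * threshold j.
  apply: (@le_trans _ _ (#|A mu r n j|%:R * threshold j)).
    by apply: ler_sum_card => K; rewrite ge_min lexx orbT.
  by rewrite ler_wpM2r// card_A_le.
apply: le_trans (ler_sum_card hA) _.
apply: (@le_trans _ _ (c * 2 `^ (upsilon * j%:R) *
    (2 `^ (dstar mu * j%:R) / (L d r n)%:R ^+ d * threshold j))).
  rewrite ler_wpM2r ?card_B_le// mulr_ge0// divr_ge0 ?powR_ge0// ltW//.
rewrite le_eqVlt; apply/orP; left; apply/eqP.
have -> : 2 `^ (j%:R * sigma) =
    2 `^ (upsilon * j%:R) * 2 `^ (dstar mu * j%:R) * 2 `^ (delta * j%:R) :> R.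
  by rewrite -!powRD_gt0//; congr (_ `^ _); rewrite /sigma; ring.
by rewrite /threshold; move: Ld; set Lp := (L d r n)%:R ^+ d => Ld; field; rewrite gt_eqF.
Qed.

Lemma oracle_loss_le_sum_sqr j :
  oracle_loss j <= 10 * \sum_(l : B c upsilon j) \sum_(k : D mu j) theta l k ^+ 2.
Proof.
have S0 : 0 <= \sum_(l : B c upsilon j) \sum_(k : D mu j) theta l k ^+ 2.
  by apply: sumr_ge0 => l _; apply: sumr_ge0 => k _; exact: sqr_ge0.
rewrite /oracle_loss; case: ifP => _; last by lra.
rewrite ler_wpM2l//; apply: ler_sum => l _.
apply: le_trans (sum_blocks_le (fun k => sqr_ge0 (theta l k))).
by apply: ler_sum => K _; rewrite ge_min lexx.
Qed.

Lemma oracle_loss_sum_split (X b : R) (N : nat) : 0 < sigma -> 0 < X ->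
  (forall j, 2 `^ j%:R <= X -> (j <= Jstar mu upsilon r delta n)%N) ->
  \sum_(j < N | X < 2 `^ j%:R) oracle_loss j <= b ->
  \sum_(j < N) oracle_loss j <=
    10 * c * lambda * (1 - 2 `^ (- sigma))^-1 * (n%:R `^ (- r) * X `^ sigma) + b.
Proof.
move=> s0 X0 XJ tail; rewrite (bigID (fun j : 'I_N => 2 `^ j%:R <= X))/=.
apply: lerD; last first.
  by rewrite (eq_bigl (fun j : 'I_N => X < 2 `^ j%:R))// => j; rewrite ltNge.
apply: (@le_trans _ _ (\sum_(j < N | 2 `^ j%:R <= X)
    10 * c * lambda * n%:R `^ (- r) * 2 `^ (j%:R * sigma))).
  by apply: ler_sum => j jX; apply: oracle_loss_le_threshold; exact: XJ.
rewrite -mulr_sumr; have -> : 10 * c * lambda * (1 - 2 `^ (- sigma))^-1 *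
  (n%:R `^ (- r) * X `^ sigma) =
  10 * c * lambda * n%:R `^ (- r) * ((1 - 2 `^ (- sigma))^-1 * X `^ sigma) by ring.
by rewrite ler_wpM2l ?geometric_sum_le// !mulr_ge0 ?powR_ge0// ltW.
Qed.

(** * Summing the oracle losses over the smoothness space *)

Section InTheta.
Variables (s : R) (p q : \bar R) (M : R).
Hypotheses (s_gt0 : 0 < s) (p_gt0 : (0 < p)%E) (q_gt0 : (0 < q)%E) (M_gt0 : 0 < M).
Hypotheses (c_ge1 : 1 <= c) (upsilon_ge0 : 0 <= upsilon) (sigma_gt0 : 0 < sigma).
Hypothesis theta_in : Theta mu c upsilon s p q M theta.

Let rate : R := 2 * s * r / (2 * s + sigma).

Let den_gt0 : 0 < 2 * s + sigma. Proof. by rewrite addr_gt0// mulr_gt0. Qed.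

Let n_ge1 : 1 <= n%:R :> R. Proof. by rewrite ler1n. Qed.

Let inv_nR_powR t : n%:R^-1 `^ t = n%:R `^ (- t) :> R.
Proof. by rewrite -powR_inv1// -powRrM mulN1r. Qed.

Let below_Jstar (X : R) j : X <= n%:R `^ (r / sigma) -> 2 `^ j%:R <= X ->
  (j <= Jstar mu upsilon r delta n)%N.
Proof.
move=> Xn jX; have /andP[_ h] := pow2_Jstar r_gt0 n_gt0 sigma_gt0.
rewrite -ltnS -(ltr_nat R) -(ltr_pM2r sigma_gt0).
rewrite -(ltr_pM2r (_ : 0 < ln 2)) ?ln_gt0 ?ltr1n// -ltr_expR -!powR_expR//.
apply: le_lt_trans h; rewrite powRrM.
apply: le_trans (_ : (n%:R `^ (r / sigma)) `^ sigma <= _).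
  by rewrite ge0_ler_powR ?nnegrE ?powR_ge0 ?(ltW sigma_gt0)// (le_trans jX).
by rewrite -powRrM divfK// gt_eqF.
Qed.

Let above_Jstar j : (Jstar mu upsilon r delta n < j)%N -> n%:R `^ (r / sigma) < 2 `^ j%:R :> R.
Proof. by move=> Jj; rewrite ltNge; apply: contraL Jj; rewrite -leqNgt; exact: below_Jstar. Qed.

Lemma oracle_loss_sum_p_ge2 N : (2%:E <= p)%E -> (q <= 2%:E)%E \/ upsilon = 0 ->
  \sum_(j < N) oracle_loss j <=
    (10 * c * lambda * (1 - 2 `^ (- sigma))^-1 +
     10 * (c * M `^ 2) * (1 - 2 `^ (- (2 * s)))^-1) * n%:R `^ (- rate).
Proof.
(* This cutoff makes [n^(-r) X^sigma] and [X^(-2 s)] both equal to [n^(-rate)]. *)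
move=> p2 q2; pose X : R := n%:R `^ (r / (2 * s + sigma)).
have X0 : 0 < X by exact: powR_gt0.
have Xn : X <= n%:R `^ (r / sigma).
  by rewrite ler_powR// ler_wpM2l ?(ltW r_gt0)// lef_pV2 ?posrE// lerDr mulr_ge0// ltW.
have s2 : 0 < 2 * s by rewrite mulr_gt0.
have XE : n%:R `^ (- r) * X `^ sigma = n%:R `^ (- rate).
  rewrite /X -powRrM -powRD_gt0//; congr (_ `^ _); rewrite /rate; field.
  by rewrite gt_eqF.
have XE2 : X `^ (- (2 * s)) = n%:R `^ (- rate).
  by rewrite /X -powRrM; congr (_ `^ _); rewrite /rate; field; rewrite gt_eqF.
have tail : \sum_(j < N | X < 2 `^ j%:R) oracle_loss j <=
    10 * (c * M `^ 2) * ((1 - 2 `^ (- (2 * s)))^-1 * X `^ (- (2 * s))).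
  apply: (@le_trans _ _ (\sum_(j < N | X < 2 `^ j%:R)
      10 * (c * M `^ 2) * 2 `^ (- (j%:R * (2 * s))))).
    apply: ler_sum => j _; apply: le_trans (oracle_loss_le_sum_sqr j) _.
    rewrite -mulrA ler_wpM2l//.
    apply: (@le_trans _ _ (\sum_(l : B c upsilon j)
        2 `^ (- (j%:R * (2 * s))) * level_norm s p theta l `^ 2)).
      by apply: ler_sum => l _; exact: sum_theta_sqr_p_ge2.
    rewrite -mulr_sumr mulrC ler_wpM2r ?powR_ge0//.
    exact: (sum_level_norm_le c_ge1 q_gt0 M_gt0 theta_in).
  by rewrite -mulr_sumr ler_wpM2l ?geometric_tail_le// mulr_ge0// mulr_ge0 ?powR_ge0.
apply: le_trans (oracle_loss_sum_split sigma_gt0 X0 (fun j => below_Jstar Xn) tail) _.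
by rewrite XE XE2 le_eqVlt; apply/orP; left; apply/eqP; ring.
Qed.

Lemma oracle_loss_le_p_lt2 (p' : R) j : p = p'%:E -> p' < 2 -> 1 <= r -> 1 <= ln (n%:R : R) ->
  (q <= p)%E \/ upsilon = 0 -> (j <= Jstar mu upsilon r delta n)%N ->
  oracle_loss j <= 10 * (c * M `^ p') * (lambda * r) `^ (1 - p' / 2) *
    (ln n%:R / n%:R) `^ (r * (1 - p' / 2)) *
    2 `^ (- (j%:R * (s * p' - (1 - p' / 2) * sigma))).
Proof.
move=> pE p2 r1 ln1 qp jJ.
have p'0 : 0 < p' by rewrite -lte_fin -pE.
have e0 : 0 < 1 - p' / 2 by rewrite subr_gt0 ltr_pdivrMr// mul1r.
set e := 1 - p' / 2 in e0 *.
set w : R := ln n%:R / n%:R.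
have ln0 : 0 < ln (n%:R : R) := lt_le_trans ltr01 ln1.
have w0 : 0 < w by rewrite divr_gt0.
have Tle : threshold j <= lambda * r * w `^ r * 2 `^ (delta * j%:R).
  (* The single logarithm brought by [L^d] is enlarged to [(ln n)^r], using [1 <= r] and
     [1 <= ln n], so that everything is a power of [w]. *)
  have h : n%:R `^ (- r) * ln n%:R <= w `^ r.
    rewrite /w powRM ?invr_ge0 ?(ltW ln0)// inv_nR_powR mulrC.
    by rewrite ler_wpM2r ?powR_ge0// -[leLHS]powRr1 ?(ltW ln0)// ler_powR.
  apply: (@le_trans _ _ (lambda * n%:R `^ (- r) * 2 `^ (delta * j%:R) * (r * ln n%:R))).
    by rewrite ler_wpM2l ?L_pow_le ?(ltW ln0)// !mulr_ge0 ?powR_ge0// ltW.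
  have -> : lambda * n%:R `^ (- r) * 2 `^ (delta * j%:R) * (r * ln n%:R) =
    lambda * r * (n%:R `^ (- r) * ln n%:R) * 2 `^ (delta * j%:R) by ring.
  by rewrite ler_wpM2r ?powR_ge0// ler_wpM2l// mulr_ge0// ltW.
have Te : threshold j `^ e <= (lambda * r) `^ e * w `^ (r * e) * 2 `^ (delta * j%:R * e).
  have lr0 : 0 <= lambda * r by rewrite mulr_ge0// ltW.
  apply: (@le_trans _ _ ((lambda * r * w `^ r * 2 `^ (delta * j%:R)) `^ e)).
    rewrite ge0_ler_powR ?nnegrE ?(ltW e0) ?(ltW (threshold_gt0 j))//.
    by rewrite !mulr_ge0 ?powR_ge0 ?(ltW lambda_gt0) ?(ltW r_gt0).
  rewrite powRM ?powR_ge0 ?mulr_ge0 ?powR_ge0 ?(ltW lambda_gt0) ?(ltW r_gt0)//.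
  by rewrite powRM ?powR_ge0// -!powRrM.
have blocks (l : B c upsilon j) : \sum_(K : A mu r n j)
    Num.min (\sum_(k in U K) theta l k ^+ 2) (threshold j) <=
    threshold j `^ e * \sum_k `|theta l k| `^ p'.
  apply: (@le_trans _ _ (\sum_(K : A mu r n j)
      threshold j `^ e * \sum_(k in U K) `|theta l k| `^ p')).
    by apply: ler_sum => K _; exact: min_sum_sqr_le (ltW p2) (threshold_gt0 j).
  rewrite -mulr_sumr ler_wpM2l ?powR_ge0//.
  by apply: sum_blocks_le => k; exact: powR_ge0.
have sumB : \sum_(l : B c upsilon j) \sum_k `|theta l k| `^ p' <=
    2 `^ (- (j%:R * (p' * (s + dstar mu / 2) - dstar mu))) * (c * M `^ p').
  rewrite (eq_bigr _ (fun l _ => sum_theta_powR s theta pE p'0 l)) -mulr_sumr.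
  rewrite ler_wpM2l ?powR_ge0//.
  by apply: (sum_level_norm_le c_ge1 q_gt0 M_gt0 theta_in) => //; rewrite -pE.
rewrite /oracle_loss jJ -!mulrA ler_wpM2l//.
apply: (@le_trans _ _ (threshold j `^ e *
    \sum_(l : B c upsilon j) \sum_k `|theta l k| `^ p')).
  by rewrite mulr_sumr; apply: ler_sum => l _; exact: blocks.
apply: (@le_trans _ _ ((lambda * r) `^ e * w `^ (r * e) * 2 `^ (delta * j%:R * e) *
    (2 `^ (- (j%:R * (p' * (s + dstar mu / 2) - dstar mu))) * (c * M `^ p')))).
  apply: ler_pM => //; first exact: powR_ge0.
  by apply: sumr_ge0 => l _; apply: sumr_ge0 => k _; exact: powR_ge0.
set E1 := 2 `^ (delta * j%:R * e); set E2 := 2 `^ (- (j%:R * (p' * _ - _))).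
have -> : (lambda * r) `^ e * w `^ (r * e) * E1 * (E2 * (c * M `^ p')) =
  c * (M `^ p' * ((lambda * r) `^ e * (w `^ (r * e) * (E1 * E2)))) by ring.
rewrite ler_wpM2l//; do 3 (rewrite ler_wpM2l ?powR_ge0//).
(* The exact decay rate is [s p' - e (dstar + delta)]; it is weakened by [e upsilon] to bring in
   [sigma], for which the sums on both sides of the cutoff balance. *)
rewrite /E1 /E2 -powRD_gt0// ler_powR ?ler1n// -subr_ge0.
have -> : - (j%:R * (s * p' - e * sigma)) -
  (delta * j%:R * e + - (j%:R * (p' * (s + dstar mu / 2) - dstar mu))) =
  j%:R * e * upsilon by rewrite /sigma /e; field.
by rewrite !mulr_ge0// ltW.
Qed.

(** Each lower bound on [s * p'] makes one series converge: the one with [sigma] for the levels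
    between the cutoff and [Jstar], the one with [dstar] for the bias beyond [Jstar]. *)
Lemma oracle_loss_sum_p_lt2 (p' : R) N : p = p'%:E -> p' < 2 -> 1 <= r -> 1 <= ln (n%:R : R) ->
  0 <= dstar mu -> Num.max (dstar mu) ((1 - p' / 2) * sigma) < s * p' ->
  (q <= p)%E \/ upsilon = 0 ->
  \sum_(j < N) oracle_loss j <=
    (10 * c * lambda * (1 - 2 `^ (- sigma))^-1 +
     (10 * (c * M `^ p') * (lambda * r) `^ (1 - p' / 2) *
        (1 - 2 `^ (- (s * p' - (1 - p' / 2) * sigma)))^-1 +
      c * M `^ 2 * (1 - 2 `^ (- (2 * (s + dstar mu / 2 - dstar mu / p'))))^-1)) *
    (ln n%:R / n%:R) `^ rate.
Proof.
move=> pE p2 r1 ln1 d0; rewrite gt_max => /andP[dsp sp] qp.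
have p'0 : 0 < p' by rewrite -lte_fin -pE.
have e0 : 0 < 1 - p' / 2 by rewrite subr_gt0 ltr_pdivrMr// mul1r.
set e := 1 - p' / 2 in e0 sp *.
set a := s * p' - e * sigma.
have a0 : 0 < a by rewrite subr_gt0.
set s' := s + dstar mu / 2 - dstar mu / p'.
have dp : dstar mu / p' < s by rewrite ltr_pdivrMr.
have d2 : 0 <= dstar mu / 2 by rewrite divr_ge0.
have s'0 : 0 < 2 * s' by rewrite mulr_gt0// /s'; lra.
set w : R := ln n%:R / n%:R.
have ln0 : 0 < ln (n%:R : R) := lt_le_trans ltr01 ln1.
have w0 : 0 < w by rewrite divr_gt0.
have nw : n%:R^-1 <= w by rewrite ler_peMl// invr_ge0.
pose X : R := w `^ (- (r / (2 * s + sigma))).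
have X0 : 0 < X by exact: powR_gt0.
have rden0 : 0 < r / (2 * s + sigma) by rewrite divr_gt0.
have Xn : X <= n%:R `^ (r / sigma).
  apply: (@le_trans _ _ (n%:R `^ (r / (2 * s + sigma)))).
    rewrite -[X in n%:R `^ X]opprK -inv_nR_powR /X !powRN.
    rewrite lef_pV2 ?posrE ?powR_gt0 ?invr_gt0//.
    by rewrite ge0_ler_powR ?nnegrE ?(ltW rden0) ?(ltW w0)// invr_ge0.
  by rewrite ler_powR// ler_wpM2l ?(ltW r_gt0)// lef_pV2 ?posrE// lerDr mulr_ge0// ltW.
have XE : n%:R `^ (- r) * X `^ sigma <= w `^ rate.
  have -> : w `^ rate = w `^ r * X `^ sigma.
    rewrite /X -powRrM -powRD_gt0//; congr (_ `^ _); rewrite /rate; field.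
    by rewrite gt_eqF.
  rewrite ler_wpM2r ?powR_ge0// -inv_nR_powR.
  by rewrite ge0_ler_powR ?nnegrE ?(ltW r_gt0) ?(ltW w0) ?invr_ge0.
have XaE : w `^ (r * e) * X `^ (- a) = w `^ rate.
  rewrite /X -powRrM -powRD_gt0//; congr (_ `^ _); rewrite /rate /a /e; field.
  by rewrite gt_eqF.
(* Levels with [2^j > Y] contain all those above [Jstar], where the estimator
   vanishes. *)
pose Y : R := n%:R `^ (r / sigma).
have Y0 : 0 < Y by exact: powR_gt0.
(* The bias beyond [Jstar] stays within the rate if [s sigma <= s' (2 s + sigma)]. As
   [s' = s - e dstar / p'], this is the inequality [Ds], in which both lower bounds on [s * p'] are
   used. *)
have YE : Y `^ (- (2 * s')) <= w `^ rate.
  have -> : Y `^ (- (2 * s')) = n%:R^-1 `^ (r / sigma * (2 * s')).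
    by rewrite inv_nR_powR -powRrM; congr (_ `^ _); ring.
  apply: (@le_trans _ _ (n%:R^-1 `^ rate)); last first.
    rewrite ge0_ler_powR ?nnegrE ?(ltW w0) ?invr_ge0//.
    by rewrite /rate !mulr_ge0 ?invr_ge0 ?(ltW r_gt0) ?(ltW s_gt0) ?(ltW den_gt0).
  rewrite !inv_nR_powR ler_powR// lerN2.
  have Ds : dstar mu / p' * e * (2 * s + sigma) <= 2 * s ^+ 2.
    apply: (@le_trans _ _ (s * e * (2 * s + sigma))).
      by rewrite ler_wpM2r ?(ltW den_gt0)// ler_wpM2r ?(ltW e0)// ltW.
    have -> : s * e * (2 * s + sigma) = s * (2 * s * e + e * sigma) by ring.
    have -> : 2 * s ^+ 2 = s * (2 * s * e + s * p') by rewrite /e; field.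
    by rewrite ler_wpM2l ?(ltW s_gt0)// lerD2l ltW.
  have ss' : s * sigma <= s' * (2 * s + sigma).
    rewrite -subr_ge0.
    have -> : s' * (2 * s + sigma) - s * sigma =
      2 * s ^+ 2 - dstar mu / p' * e * (2 * s + sigma).
      by rewrite /s' /e; field; rewrite gt_eqF.
    by rewrite subr_ge0.
  rewrite /rate ler_pdivrMr//.
  have -> : 2 * s * r = 2 * (r / sigma) * (s * sigma) by field; rewrite gt_eqF.
  have -> : r / sigma * (2 * s') * (2 * s + sigma) =
    2 * (r / sigma) * (s' * (2 * s + sigma)) by ring.
  by rewrite ler_wpM2l// mulr_ge0// divr_ge0// ltW.
have tail : \sum_(j < N | X < 2 `^ j%:R) oracle_loss j <=
    10 * (c * M `^ p') * (lambda * r) `^ e * (1 - 2 `^ (- a))^-1 * w `^ rate +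
    c * M `^ 2 * (1 - 2 `^ (- (2 * s')))^-1 * w `^ rate.
  set C1 := 10 * (c * M `^ p') * (lambda * r) `^ e.
  have C10 : 0 <= C1 by rewrite !mulr_ge0 ?powR_ge0.
  have C20 : 0 <= c * M `^ 2 by rewrite mulr_ge0 ?powR_ge0.
  (* A level above the cutoff is charged to the first series if it is at most [Jstar], to the second
     otherwise; nonnegativity lets each series run over all indices allowed by its own cutoff. *)
  apply: (@le_trans _ _ (\sum_(j < N | X < 2 `^ j%:R) C1 * w `^ (r * e) * 2 `^ (- (j%:R * a)) +
    \sum_(j < N | Y < 2 `^ j%:R) c * M `^ 2 * 2 `^ (- (j%:R * (2 * s'))))); last first.
    rewrite -!mulr_sumr; apply: lerD.
      have -> : C1 * (1 - 2 `^ (- a))^-1 * w `^ rate =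
        C1 * w `^ (r * e) * ((1 - 2 `^ (- a))^-1 * X `^ (- a)) by rewrite -XaE; ring.
      by rewrite ler_wpM2l ?geometric_tail_le// mulr_ge0 ?powR_ge0.
    rewrite -[leRHS]mulrA ler_wpM2l//.
    apply: le_trans (geometric_tail_le s'0 Y0 N) _.
    by rewrite ler_wpM2l// ltW// geometric_ratio_gt0.
  rewrite [X in _ <= X + _]big_mkcond [X in _ <= _ + X]big_mkcond -big_split big_mkcond/=.
  apply: ler_sum => j _.
  have t1 : 0 <= C1 * w `^ (r * e) * 2 `^ (- (j%:R * a)) by rewrite !mulr_ge0 ?powR_ge0.
  have t2 : 0 <= c * M `^ 2 * 2 `^ (- (j%:R * (2 * s'))) by rewrite mulr_ge0 ?powR_ge0.
  case: ifP => Xj; last by rewrite add0r; case: ifP.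
  have [jJ|Jj] := leqP j (Jstar mu upsilon r delta n).
    apply: le_trans (oracle_loss_le_p_lt2 pE p2 r1 ln1 qp jJ) _.
    by rewrite lerDl; case: ifP.
  rewrite [X in _ + (if X then _ else _)](above_Jstar Jj) -[leLHS]add0r; apply: lerD => //.
  rewrite /oracle_loss leqNgt Jj/=.
  apply: (@le_trans _ _ (\sum_(l : B c upsilon j)
      2 `^ (- (j%:R * (2 * s'))) * level_norm s p theta l `^ 2)).
    by apply: ler_sum => l _; exact: (sum_theta_sqr_p_le2 s theta pE p'0 (ltW p2)).
  rewrite -mulr_sumr mulrC ler_wpM2r ?powR_ge0//.
  apply: (sum_level_norm_le c_ge1 q_gt0 M_gt0 theta_in) => //.
  case: qp => [qp|]; [left|by right].
  by apply: le_trans qp _; rewrite pE lee_fin ltW.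
apply: le_trans (oracle_loss_sum_split sigma_gt0 X0 (fun j => below_Jstar Xn) tail) _.
rewrite -mulrDl [leRHS]mulrDl lerD2r ler_wpM2l//.
by rewrite !mulr_ge0 ?(ltW lambda_gt0) ?(ltW (geometric_ratio_gt0 sigma_gt0)).
Qed.

End InTheta.

End RiskBounds.

(** * Assembling the noise conditions and the rates *)

Theorem proposition3p1 (R : realType) (d : nat) (d_gt0 : (0 < d)%N)
  (r : R) (r_range : 1 <= r <= d%:R)
  (c : R) (c_ge1 : 1 <= c)
  (upsilon : R) (upsilon_range : 0 <= upsilon <= 1)
  (mu : 'I_d -> R) (mu_gt0 : forall i, 0 < mu i)
  (delta : R) (delta_ge0 : 0 <= delta)
  (disp : nat -> measure_display)
  (T : forall n : nat, measurableType (disp n))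
  (P : forall n : nat, probability (T n) R)
  (z : forall n : nat, level_family mu c upsilon {RV (P n) >-> R})
  (Q3 Q4 : R) (Q3_gt0 : 0 < Q3) (Q4_gt0 : 0 < Q4)
  (z_gaussian : \forall n \near \oo, gaussian_noise n (z n))
  (z_A3 : \forall n \near \oo, A3 delta n (z n) Q3)
  (z_A4 : \forall n \near \oo, A4 r delta n (z n) Q4) :
  let lambda := 4 * ((2 * Q4) `^ 2^-1 + Q3 `^ 4^-1) ^+ 2 in
  (exists2 Q1 : R, 0 < Q1 &
     \forall n \near \oo, A1 delta n (z n) Q1) /\
  (exists2 Q2 : R, 0 < Q2 &
     \forall n \near \oo, (Jstar mu upsilon r delta n <= J R n)%N ->
       A2 r delta n (z n) lambda Q2) /\
  (forall (s : R) (p q : \bar R) (M : R),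
     0 < s -> (0 < p)%E -> (0 < q)%E -> 0 < M ->
     let sigma := delta + dstar mu + upsilon in
     let rate_holds (rho : nat -> R) :=
       exists2 C : R, 0 < C &
         \forall n \near \oo, (Jstar mu upsilon r delta n <= J R n)%N ->
           (ereal_sup [set risk r delta lambda n (z n) theta
                      | theta in Theta mu c upsilon s p q M]
            <= (C * rho n)%:E)%E in
     ((2%:E <= p)%E -> (q <= 2%:E)%E \/ upsilon = 0 ->
        rate_holds (fun n => n%:R `^ (- (2 * s * r / (2 * s + sigma))))) /\
     ((p < 2%:E)%E ->
      Num.max (dstar mu) ((1 - fine p / 2) * sigma) < s * fine p ->
      (q <= p)%E \/ upsilon = 0 ->
        rate_holds (fun n =>
          (ln n%:R / n%:R) `^ (2 * s * r / (2 * s + sigma))))).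
Proof.
move=> lambda; have /andP[r_ge1 _] := r_range; have /andP[upsilon_ge0 _] := upsilon_range.
have r_gt0 : 0 < r := lt_le_trans ltr01 r_ge1.
have c_gt0 : 0 < c := lt_le_trans ltr01 c_ge1.
have c_ge0 := ltW c_gt0.
have dstar_gt0 : 0 < dstar mu.
  rewrite /dstar (bigD1 (Ordinal d_gt0))//= ltr_pwDl// sumr_ge0// => i _.
  exact: ltW.
have sum_gt0 : 0 < dstar mu + delta + upsilon by rewrite ltr_pwDl// ltr_pwDl.
have Q_gt0 : 0 < Q3 `^ 2^-1 by exact: powR_gt0.
have g_gt0 : 0 < Q3 `^ 4^-1 / (2 * Q4) `^ 2^-1 by rewrite divr_gt0 ?powR_gt0// mulr_gt0.
have lambda_gt0 : 0 < lambda by rewrite mulr_gt0// exprn_gt0// addr_gt0 ?powR_gt0// mulr_gt0.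
have [u0 [u1 [eps [u1_ge0 u10 u01 eps_gt0 gap]]]] := gaussian_gap g_gt0.
set g := Q3 `^ 4^-1 / _ in g_gt0 gap.
pose Q2 := c * (2 * Q4 / (u0 - u1)) * (1 - 2 `^ (- (dstar mu + delta + upsilon)))^-1.
have Q2_gt0 : 0 < Q2.
  rewrite mulr_gt0 ?geometric_ratio_gt0// mulr_gt0// divr_gt0 ?subr_gt0//.
  by rewrite mulr_gt0.
have zA2 : \forall n \near \oo, (Jstar mu upsilon r delta n <= J R n)%N ->
    A2 r delta n (z n) lambda Q2.
  near=> n => JJ.
  have zn : gaussian_noise n (z n) by near: n; exact: z_gaussian.
  have zn3 : A3 delta n (z n) Q3 by near: n; exact: z_A3.
  have zn4 : A4 r delta n (z n) Q4 by near: n; exact: z_A4.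
  have n_gt0 : (0 < n)%N by near: n; exact: nbhs_infty_gt.
  have L_gt0 : (0 < L d r n)%N by near: n; exact: L_ge1.
  have L_large : r * ln (n%:R : R) <= (1 + eps) * (L d r n)%:R ^+ d.
    by near: n; exact: L_pow_ge.
  exact: (noise_A2 r_gt0 c_ge0 Q3_gt0 Q4_gt0 zn zn3 zn4 u1_ge0 u10 u01 gap).
split.
  exists (Q3 `^ 2^-1) => //; near=> n; apply: noise_A1 => //.
  by near: n; exact: z_A3.
split; first by exists Q2.
move=> s p q M s_gt0 p_gt0 q_gt0 M_gt0 sigma rate_holds.
have sigmaE : dstar mu + delta + upsilon = sigma by rewrite /sigma [dstar mu + _]addrC.
set rate := 2 * s * r / (2 * s + sigma).
have sigma_gt0 : 0 < sigma by rewrite -sigmaE.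
(* The strict inequality leaves the factor [n^(r - rate)], which absorbs the power of [ln n] hidden
   in [2^(j0 sigma)]. *)
have rate_lt : rate < r.
  have den_gt0 : 0 < 2 * s + sigma by rewrite addr_gt0// mulr_gt0.
  by rewrite /rate ltr_pdivrMr// [X in X < _]mulrC ltr_pM2l// ltrDl.
pose C0 := c * Q3 `^ 2^-1 * (1 - 2 `^ (- sigma))^-1 + 10 * Q2.
have C0_gt0 : 0 < C0.
  apply: addr_gt0; last by rewrite mulr_gt0.
  by rewrite mulr_gt0 ?geometric_ratio_gt0// mulr_gt0.
(* Here [theta] is quantified after [n], so that the rank from which the inequality holds is uniform
   over the smoothness space. *)
pose oracle_inequality n := forall (theta : level_family mu c upsilon R) (b : R),
    (forall N, \sum_(j < N) oracle_loss r delta lambda n theta j <= b) ->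
    (risk r delta lambda n (z n) theta <= (C0 * n%:R `^ (- rate) + b)%:E)%E.
have zrisk : \forall n \near \oo, (Jstar mu upsilon r delta n <= J R n)%N ->
    oracle_inequality n.
  near=> n => JJ theta b theta_b.
  have n_gt0 : (0 < n)%N by near: n; exact: nbhs_infty_gt.
  have L_gt0 : (0 < L d r n)%N by near: n; exact: L_ge1.
  have j0J : (j0 mu r n <= J R n)%N by near: n; exact: j0_le_J.
  have zn3 : A3 delta n (z n) Q3 by near: n; exact: z_A3.
  have znA2 : A2 r delta n (z n) lambda Q2 by move: JJ; near: n; exact: zA2.
  have zQ j : (j < j0 mu r n)%N -> forall (l : B c upsilon j) (k : D mu j),
      ('E_(P n)[fun w => (z n j l k w ^+ 2)%R] <=
       (Q3 `^ 2^-1 * 2 `^ (delta * j%:R))%:E)%E.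
    by move=> jj0 l k; apply: (noise_sqr_le Q3_gt0 zn3); rewrite (leq_trans (ltnW jj0)).
  apply: le_trans (risk_le c_ge0 lambda_gt0 n_gt0 L_gt0 (ltW Q_gt0) sum_gt0 zQ znA2 theta_b) _.
  have low : n%:R `^ (- r) * 2 `^ ((j0 mu r n)%:R * sigma) <= n%:R `^ (- rate) :> R.
    apply: (@le_trans _ _ (n%:R `^ (- r) * n%:R `^ (r - rate))).
      rewrite ler_wpM2l ?powR_ge0//; near: n; apply: j0_pow_dominated => //.
        exact: ltW.
      by rewrite subr_gt0.
    by rewrite -powRD_gt0 ?ltr0n// addKr.
  rewrite lee_fin lerD2r sigmaE [leRHS]mulrDl; apply: lerD.
    have -> : c * Q3 `^ 2^-1 * n%:R `^ (- r) *
        ((1 - 2 `^ (- sigma))^-1 * 2 `^ ((j0 mu r n)%:R * sigma)) =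
      c * Q3 `^ 2^-1 * (1 - 2 `^ (- sigma))^-1 *
        (n%:R `^ (- r) * 2 `^ ((j0 mu r n)%:R * sigma)) by ring.
    by rewrite ler_wpM2l// ltW// !mulr_gt0// geometric_ratio_gt0.
  rewrite mulrAC ler_wpM2l//; first by rewrite mulr_ge0// ltW.
  by rewrite ler_powR ?ler1n// lerN2 ltW.
split=> [p_ge2 q_le|p_lt2 sp q_le].
  pose C1 := 10 * c * lambda * (1 - 2 `^ (- sigma))^-1 +
    10 * (c * M `^ 2) * (1 - 2 `^ (- (2 * s)))^-1.
  have C1_gt0 : 0 < C1.
    have s2 : 0 < 2 * s by rewrite mulr_gt0.
    apply: addr_gt0; first by rewrite mulr_gt0 ?geometric_ratio_gt0// mulr_gt0// mulr_gt0.
    by rewrite mulr_gt0 ?geometric_ratio_gt0// mulr_gt0// mulr_gt0// powR_gt0.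
  exists (C0 + C1); first exact: addr_gt0.
  near=> n => JJ; apply: ge_ereal_sup => _ [theta theta_in <-].
  have n_gt0 : (0 < n)%N by near: n; exact: nbhs_infty_gt.
  have L_gt0 : (0 < L d r n)%N by near: n; exact: L_ge1.
  have zn : oracle_inequality n by move: JJ; near: n; exact: zrisk.
  rewrite mulrDl; apply: zn => N; rewrite /C1 /rate -sigmaE.
  by apply: (oracle_loss_sum_p_ge2 _ _ _ _ _ _ _ _ _ _ theta_in).
case pE : p p_gt0 p_lt2 sp => [p'| |//] p_gt0 p_lt2 sp.
pose C1 := 10 * c * lambda * (1 - 2 `^ (- sigma))^-1 +
  (10 * (c * M `^ p') * (lambda * r) `^ (1 - p' / 2) *
     (1 - 2 `^ (- (s * p' - (1 - p' / 2) * sigma)))^-1 +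
   c * M `^ 2 * (1 - 2 `^ (- (2 * (s + dstar mu / 2 - dstar mu / p'))))^-1).
have C1_gt0 : 0 < C1.
  have dsp : dstar mu < s * p' by move: sp; rewrite gt_max => /andP[].
  have a_gt0 : 0 < s * p' - (1 - p' / 2) * sigma.
    by rewrite subr_gt0; move: sp; rewrite gt_max => /andP[].
  have s'_gt0 : 0 < 2 * (s + dstar mu / 2 - dstar mu / p').
    have : dstar mu / p' < s by rewrite ltr_pdivrMr.
    by have := divr_gt0 dstar_gt0 (@ltr0n R 2); rewrite mulr_gt0//; lra.
  apply: addr_gt0; first by rewrite mulr_gt0 ?geometric_ratio_gt0// mulr_gt0// mulr_gt0.
  apply: addr_gt0; rewrite mulr_gt0 ?geometric_ratio_gt0//; last first.
    by rewrite mulr_gt0// powR_gt0.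
  apply: mulr_gt0; last by rewrite powR_gt0// mulr_gt0.
  by rewrite mulr_gt0// mulr_gt0// powR_gt0.
exists (C0 + C1); first exact: addr_gt0.
near=> n => JJ; apply: ge_ereal_sup => _ [theta theta_in <-].
have n_gt0 : (0 < n)%N by near: n; exact: nbhs_infty_gt.
have L_gt0 : (0 < L d r n)%N by near: n; exact: L_ge1.
have ln_ge1 : 1 <= ln (n%:R : R) by near: n; exact: ln_nat_dvg.
have zn : oracle_inequality n by move: JJ; near: n; exact: zrisk.
(* Since [1 <= ln n], the contribution of the noise and of the coarse levels, stated without
   logarithm, fits in the slower rate. *)
have rate_ge : n%:R `^ (- rate) <= (ln n%:R / n%:R) `^ rate :> R.
  rewrite powRN -powR_inv1 ?powR_ge0// powRAC powR_inv1//.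
  have rate_ge0 : 0 <= rate by rewrite divr_ge0 ?mulr_ge0 ?addr_ge0 ?mulr_ge0// ltW.
  have ln_ge0 : 0 <= ln (n%:R : R) := le_trans ler01 ln_ge1.
  have inv_le : n%:R^-1 <= ln (n%:R : R) / n%:R by rewrite ler_peMl// invr_ge0.
  by apply: ge0_ler_powR => //; rewrite nnegrE ?divr_ge0// invr_ge0.
have losses N : \sum_(j < N) oracle_loss r delta lambda n theta j <=
    C1 * (ln n%:R / n%:R) `^ rate.
  rewrite /C1 /rate -sigmaE.
  apply: (oracle_loss_sum_p_lt2 d_gt0 r_gt0 c_ge0 lambda_gt0 n_gt0 L_gt0 s_gt0
    _ q_gt0 M_gt0 c_ge1 upsilon_ge0 sum_gt0 theta_in N pE) => //.
  - by rewrite pE.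
  - exact: ltW.
  - by rewrite sigmaE.
apply: le_trans (zn _ _ losses) _.
by rewrite lee_fin [leRHS]mulrDl lerD2r ler_wpM2l ?(ltW C0_gt0).
Unshelve. all: by end_near.
Qed.
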